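(* Consider the shape invariant model $Y_{i,j}=a_jf(X_i-\theta_j)+v_j+\varepsilon_{i,j}$, $1\le j\le p$, $i\ge 1$, under the assumptions listed in the context, and let $(\widehat\theta_n)$ be the projected Robbins-Monro sequence given by an initial value $\widehat\theta_0\in K^p$ and, for $n\ge0$ and $1\le j\le p$, $$\widehat\theta_{n+1,j}=\pi_K\Bigl(\widehat\theta_{n,j}+\gamma_{n+1}\,\mathrm{sign}(a_jf_1)\,T_{n+1,j}\Bigr),\qquad T_{n+1,j}=\frac{\sin\bigl(2\pi(X_{n+1}-\widehat\theta_{n,j})\bigr)}{g(X_{n+1})}\,Y_{n+1,j},$$ with $\gamma_n=1/n$. Then $\widehat\theta_n$ converges almost surely to $\theta$ as $n$ goes to $+\infty$. In addition, for $1\le j\le p$, the number of times that the random variable $\widehat\theta_{n,j}+\gamma_{n+1}\,\mathrm{sign}(a_jf_1)\,T_{n+1,j}$ goes outside of $K$ is almost surely finite.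
   Context: Setting. Let $p\ge2$ be an integer. - The observation times $(X_i)$ are independent and identically distributed with probability density function $g$, positive on its support $[-1/2,1/2]$. In addition, $g$ is continuous on $\mathbb R$, twice differentiable with bounded derivatives. - The shape function $f$ is symmetric ($f(-x)=f(x)$), bounded, periodic with period $1$, and $\int_{-1/2}^{1/2}f(x)\,dx=0$. Its first Fourier coefficient $f_1=\int_{-1/2}^{1/2}\cos(2\pi x)f(x)\,dx$ satisfies $f_1\ne0$. - $a=(a_1,\dots,a_p)^T$, $\theta=(\theta_1,\dots,\theta_p)^T$, $v=(v_1,\dots,v_p)^T$ are vectors of $\mathbb R^p$ with $a_j\ne0$ for all $j$, $a_1=1$, $\theta_1=0$ and $\max_{1\le j\le p}|\theta_j|<1/4$. - The noise $(\varepsilon_{i,j})$ is a sequence of independent random variables with mean zero and variances $\mathbb E[\varepsilon_{i,j}^2]=\sigma_j^2$, independent of the random points $X_i$; for each $j$, the variables $(\varepsilon_{i,j})_i$ share the same distribution. - $K=[-1/4,1/4]$ and $\pi_K$ is the projection of $\mathbb R$ onto $K$: $\pi_K(x)=x$ if $|x|\le1/4$, $\pi_K(x)=1/4$ if $x\ge1/4$, $\pi_K(x)=-1/4$ if $x\le-1/4$.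
   Formalization: As stated, no density g can vanish off [-1/2,1/2], be positive on that closed interval and be continuous on ℝ; here g is positive on [-1/2,1/2] and smooth on ℝ, and only its restriction to [-1/2,1/2] is the density of the X_i. *)

(* Defs.v *)
From HB Require Import structures.
From mathcomp Require Import all_boot all_order all_algebra finmap.
From mathcomp Require Import all_classical all_reals all_analysis.

Set Implicit Arguments.
Unset Strict Implicit.
Unset Printing Implicit Defensive.

Import Order.TTheory GRing.Theory Num.Theory.
Import numFieldNormedType.Exports.

Local Open Scope classical_set_scope.
Local Open Scope ring_scope.

Definition mutually_independent (d : measure_display) (T : measurableType d)
    (R : realType) (P : probability T R) (I : choiceType) (Z : I -> T -> R) :=
  forall (J : {fset I}) (B : I -> set R), (forall i, measurable (B i)) ->
    P (\bigcap_(i in [set` J]) (Z i @^-1` B i)) =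
    (\prod_(i <- J) P (Z i @^-1` B i))%E.

(* The sigma-algebra generated by the whole family [Z]. *)
Definition sigma_family (d : measure_display) (T : measurableType d)
    (R : realType) (I : Type) (Z : I -> T -> R) : set (set T) :=
  <<s [set A | exists i (B : set R), measurable B /\ A = Z i @^-1` B] >>.

Definition independent_families (d : measure_display) (T : measurableType d)
    (R : realType) (P : probability T R) (I J : Type)
    (Z : I -> T -> R) (W : J -> T -> R) :=
  forall A B : set T, sigma_family Z A -> sigma_family W B ->
    P (A `&` B) = (P A * P B)%E.

(* The law of [Z] is carried by [D] and has density [g] there. The values of
   [g] off [D] play no role, so that [g] may be continuous on the whole line
   and positive on a closed bounded [D]; this would be contradictory if [g]
   itself had to vanish off [D]. *)
Definition has_density_on (d : measure_display) (T : measurableType d)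
    (R : realType) (P : probability T R) (Z : {RV P >-> R}) (D : set R)
    (g : R -> R) :=
  forall B : set R, measurable B ->
    distribution P Z B = (\int[lebesgue_measure]_(x in B `&` D) (g x)%:E)%E.

Definition fourier1 (R : realType) (f : R -> R) : R :=
  \int[lebesgue_measure]_(x in `[(- 2^-1 : R), 2^-1]) (cos (2 * pi * x) * f x).

Definition K (R : realType) : set R := `[- 4^-1, 4^-1].

Definition projK (R : realType) (x : R) : R :=
  if `|x| <= 4^-1 then x else if 4^-1 <= x then 4^-1 else - 4^-1.

Definition shape_invariant (R : realType) (p : nat) (f : R -> R)
    (a theta v : 'cV[R]_p) (x : R) (e : 'I_p -> R) : 'cV[R]_p :=
  \col_j (a j 0 * f (x - theta j 0) + v j 0 + e j).

Definition rm_T (R : realType) (p : nat) (g : R -> R) (t : 'cV[R]_p) (x : R)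
    (y : 'cV[R]_p) : 'cV[R]_p :=
  \col_j (sin (2 * pi * (x - t j 0)) / g x * y j 0).

(* One Robbins-Monro step before projection, from the current value [t]. *)
Definition rm_step (R : realType) (p : nat) (f g : R -> R) (a : 'cV[R]_p)
    (c : R) (t : 'cV[R]_p) (x : R) (y : 'cV[R]_p) : 'cV[R]_p :=
  \col_j (t j 0 + c * Num.sg (a j 0 * fourier1 f) * rm_T g t x y j 0).

(* Pathwise recursion along the data [x 1, y 1, x 2, y 2, ...]; the entries
   of index 0 are not used. *)
Fixpoint rm_seq (R : realType) (p : nat) (f g : R -> R) (a : 'cV[R]_p)
    (gamma : nat -> R) (t0 : 'cV[R]_p) (x : nat -> R) (y : nat -> 'cV[R]_p)
    (n : nat) : 'cV[R]_p :=
  if n is m.+1 then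
    map_mx (@projK R)
      (rm_step f g a (gamma m.+1) (rm_seq f g a gamma t0 x y m)
         (x m.+1) (y m.+1))
  else t0.

(* Main.v *)
Require Import Defs.
From HB Require Import structures.
From mathcomp Require Import all_boot all_order all_algebra finmap.
From mathcomp Require Import all_classical all_reals all_analysis.
From mathcomp Require Import measurable_realfun zify ring lra.

Set Implicit Arguments.
Unset Strict Implicit.
Unset Printing Implicit Defensive.

Import Order.TTheory GRing.Theory Num.Theory.
Import numFieldNormedType.Exports.

Local Open Scope classical_set_scope.
Local Open Scope ring_scope.

(* Writing Z_n for the error of one coordinate, the projection does not increase
   the distance to theta, and the conditional mean of the step is
   -|a f1| sin (2 pi Z_n), whose product with Z_n is at most - kappa Z_n^2
   because |Z_n| stays below some rho < 1/2. Hence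
     E Z_{n+1}^2 <= (1 - 2 kappa/(n+1)) E Z_n^2 + C/(n+1)^2,
   so that E Z_n^2 = O(n^(-q)) for some q > 0. Along n = k^m, with m large,
   these expectations are summable and Z_n -> 0 almost surely. Between k^m and
   (k+1)^m the increments add up to at most B_k = sum |T_i|/(i+1), and
   Cauchy-Schwarz gives E B_k^2 <= C (sum 1/(i+1))^2 = O(1/k^2), again summable:
   B_k -> 0 almost surely. This replaces the martingale convergence theorem,
   and since B_k dominates each unprojected step of its block it also shows
   that only finitely many steps leave K. The conditional mean is computed
   without conditional expectations: sin (2 pi (X - t)) separates into products
   of functions of the past and of the new observation. *)

(** * Elementary estimates *)

Lemma projK_K (R : realType) (x : R) : K (Defs.projK x).
Proof.
rewrite /K/= in_itv/= /Defs.projK; case: ifPn => [|_].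
  by rewrite ler_norml.
by case: ifPn => _; lra.
Qed.

Lemma projK_dist (R : realType) (x y : R) : K y -> `|Defs.projK x - y| <= `|x - y|.
Proof.
rewrite /K/= in_itv/= /Defs.projK => /andP[y1 y2]; case: ifPn => [//|].
rewrite -ltNge ltr_normr => xK; case: ifPn => x4.
  by rewrite !ger0_norm; lra.
have {}xK : x < - 4^-1 by case/orP: xK; lra.
by rewrite !ler0_norm; lra.
Qed.

(** The projection is the clamp [max (-1/4) (min x (1/4))], built from measurable operations. *)
Lemma measurable_projK (R : realType) : measurable_fun setT (@Defs.projK R).
Proof.
rewrite (_ : @Defs.projK R = fun x => Num.max (- 4^-1) (Num.min x 4^-1)).
  by apply: measurable_maxr => //; apply: measurable_minr.
apply/funext => x; rewrite /Defs.projK; case: ifPn => [|].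
  rewrite ler_norml => /andP[x1 x2].
  by rewrite min_l// max_r.
rewrite -ltNge ltr_normr => xK; case: ifPn => x4.
  by rewrite min_r// max_r//; lra.
by rewrite min_l ?max_l//; lra.
Qed.

(** Halving the angle gives [sin y = 2 sin (y/2) cos (y/2)], and the mean value theorem turns
    [sin (y/2)] into [(y/2) cos c]. Both cosines are at least [cos (y0/2)], hence the square. *)
Lemma sin_ge (R : realType) (y0 y : R) : 0 <= y <= y0 -> y0 < pi ->
  cos (y0 / 2) ^+ 2 * y <= sin y.
Proof.
move=> /andP[y_ge0 yy0] y0pi.
have [->|yn0] := eqVneq y 0; first by rewrite sin0 mulr0.
have y_gt0 : 0 < y by rewrite lt_def yn0.
have hy : 0 < y / 2 by rewrite divr_gt0.
have inI z : 0 <= z <= y0 / 2 -> z \in `[(0:R), pi].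
  by rewrite in_itv/= => /andP[-> /le_trans->//]; lra.
have cpos z : 0 <= z <= y0 / 2 -> cos (y0 / 2) <= cos z.
  move=> zI; have z2 : y0 / 2 \in `[(0:R), pi] by apply: inI; lra.
  case/andP: (zI) => _; rewrite le_eqVlt => /predU1P[->//|zy].
  by rewrite ltW// ltr_cos// inI.
have c0 : 0 < cos (y0 / 2).
  by apply: cos_gt0_pihalf; lra.
have [c] := @MVT R sin cos 0 (y / 2) hy (fun x _ => is_derive_sin x)
  (@continuous_subspaceT _ _ _ _ (@continuous_sin R)).
rewrite in_itv/= sin0 !subr0 => /andP[c1 c2] sc.
have -> : sin y = 2 * (cos (y / 2) * sin (y / 2)).
  by rewrite mulr_natl -sin_mulr2n mulr2n -splitr.
rewrite sc.
have h1 : cos (y0 / 2) <= cos c by apply: cpos; lra.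
have h2 : cos (y0 / 2) <= cos (y / 2) by apply: cpos; lra.
have h3 : cos (y0 / 2) ^+ 2 <= cos (y / 2) * cos c.
  by rewrite expr2 ler_pM// ltW.
have := ler_wpM2r y_ge0 h3; lra.
Qed.

(* [y sin y] is even, so the bound on [0, y0] is enough. *)
Lemma mul_sin_ge (R : realType) (y0 y : R) : `|y| <= y0 -> y0 < pi ->
  cos (y0 / 2) ^+ 2 * y ^+ 2 <= y * sin y.
Proof.
move=> yy0 y0pi.
have -> : y * sin y = `|y| * sin `|y|.
  by case: (ger0P y) => _; rewrite ?sinN ?mulrNN.
rewrite -(real_normK (num_real y)) expr2 mulrA [X in _ <= X]mulrC.
by rewrite ler_wpM2r// sin_ge// normr_ge0.
Qed.

Lemma ln_succ_ge (R : realType) (n : nat) :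
  n.+2%:R^-1 <= ln (n.+2%:R : R) - ln n.+1%:R.
Proof.
have p1 : (0 : R) < n.+1%:R by rewrite ltr0n.
have p2 : (0 : R) < n.+2%:R by rewrite ltr0n.
have : ln (1 - (n.+2%:R : R)^-1) <= - n.+2%:R^-1.
  apply: le_ln1Dx; rewrite ltrN2 invf_lt1// ltr1n//.
have -> : 1 - (n.+2%:R : R)^-1 = n.+1%:R / n.+2%:R.
  by rewrite -natr1 in p2 *; field; rewrite gt_eqF.
by rewrite ln_div ?posrE// lerNr opprB.
Qed.

Lemma ln_succ_le (R : realType) (n : nat) :
  ln (n.+2%:R : R) - ln n.+1%:R <= n.+1%:R^-1.
Proof.
have p1 : (0 : R) < n.+1%:R by rewrite ltr0n.
have p2 : (0 : R) < n.+2%:R by rewrite ltr0n.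
have : ln (1 + (n.+1%:R : R)^-1) <= n.+1%:R^-1.
  by apply: le_ln1Dx; rewrite (lt_le_trans (ltrN10 _))// invr_ge0.
have -> : 1 + (n.+1%:R : R)^-1 = n.+2%:R / n.+1%:R.
  by rewrite -natr1 in p2 *; field; rewrite gt_eqF.
by rewrite ln_div ?posrE.
Qed.

Lemma sum_inv_le (R : realType) (m n : nat) : (m <= n)%N ->
  \sum_(m.+1 <= i < n.+1) (i.+1%:R^-1 : R) <= ln n.+1%:R - ln m.+1%:R.
Proof.
elim: n => [|n IHn].
  by rewrite leqn0 => /eqP->; rewrite big_geq// subrr.
rewrite leq_eqVlt => /predU1P[->|mn]; first by rewrite big_geq// subrr.
rewrite big_nat_recr//=.
by rewrite (le_trans (lerD (IHn mn) (ln_succ_ge _ n)))// addrC addrA subrK.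
Qed.

(** Comparison with the logarithm leaves [m (ln (k+2) - ln (k+1))]. The step sizes of a block thus
    add up to [O(1/k)], whose square is summable. *)
Lemma block_sum_inv_le (R : realType) (m k : nat) :
  \sum_((k.+1 ^ m)%N <= i < (k.+2 ^ m)%N) (i.+1%:R^-1 : R) <= m%:R / k.+1%:R.
Proof.
(* Powers are written as successors to match the summation bounds of [sum_inv_le]. *)
have e j : (j.+1 ^ m = (j.+1 ^ m).-1.+1)%N by rewrite prednK// expn_gt0.
rewrite (e k) (e k.+1) (le_trans (sum_inv_le _ _))//.
  by rewrite -ltnS -!e; case: (m) => // m1; rewrite leq_exp2r.
rewrite -!e !natrX !lnXn ?ltr0n// -mulrnBl -[_ *+ m]mulr_natl ler_wpM2l//.
exact: ln_succ_le.
Qed.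

Lemma sum_sqr_inv_le2 (R : realType) (n : nat) :
  \sum_(0 <= k < n) (k.+1%:R^-1 ^+ 2 : R) <= 2.
Proof.
(* The bound [2] alone does not carry an induction; the slack [1/(n+1)] pays for the next term. *)
suff H : \sum_(0 <= k < n.+1) (k.+1%:R^-1 ^+ 2 : R) <= 2 - n.+1%:R^-1.
  case: n H => [|n] H; first by rewrite big_geq.
  apply: le_trans (_ : \sum_(0 <= k < n.+2) (k.+1%:R^-1 ^+ 2 : R) <= _).
    by rewrite [leRHS]big_nat_recr//= lerDl sqr_ge0.
  by rewrite (le_trans H)// gerBl invr_ge0.
elim: n => [|n IHn]; first by rewrite big_nat1 invr1 expr1n; lra.
rewrite big_nat_recr//= (le_trans (lerD IHn (lexx _)))//.
have p1 : (0 : R) < n.+1%:R by rewrite ltr0n.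
rewrite -addrA lerD2l addrC lerBlDr addrC lerBrDr -(ler_pM2r p1) mulVf ?gt_eqF//.
rewrite -[n.+2%:R]natr1; set x : R := n.+1%:R in p1 *.
have ix : (x + 1)^-1 * x = 1 - (x + 1)^-1 by field; lra.
rewrite mulrDl expr2 -mulrA ix; have := sqr_ge0 (x + 1)^-1; rewrite expr2; lra.
Qed.

(* The exponent [1/m] is a quarter of the contraction rate [4/m] or less, so
   that [D n^(-1/m)] is a supersolution of the recursion. *)
Lemma rate_along_powers (R : realType) (u : nat -> R) (k C : R) :
  0 < k -> 0 <= C -> (forall n, 0 <= u n) ->
  (forall n, u n.+1 <= (1 - k / n.+1%:R) * u n + C / n.+1%:R ^+ 2) ->
  exists m : nat, exists2 D : R, (0 < m)%N &
    forall j, u (j.+1 ^ m)%N <= D / j.+1%:R ^+ 2.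
Proof.
move=> k0 C0 u0 uS.
(* [4/m <= k] lets the rate [4/m] replace [k], and [m >= 4] keeps the resulting factor
   nonnegative. *)
have [m m4 mk] : exists2 m : nat, (4 <= m)%N & 4 / m%:R <= k.
  exists (maxn 4 (Num.truncn (4 / k)).+1); first exact: leq_maxl.
  have mlt : 4 / k < (maxn 4 (Num.truncn (4 / k)).+1)%:R.
    rewrite (lt_le_trans (truncnS_gt _))// ler_nat leq_maxr//.
  rewrite ler_pdivrMr; last by rewrite (lt_trans _ mlt)// divr_gt0.
  by rewrite mulrC -ler_pdivrMr// ltW.
have m0 : (0 : R) < m%:R by rewrite ltr0n (leq_trans _ m4).
(* [r n] is [(n+1)^(-1/m)]. In [D], the first entry starts the induction and the second absorbs the
   term with [C]. *)
pose r n : R := expR (- (ln n.+1%:R / m%:R)).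
pose D : R := Num.max (u 1%N) (C * m%:R).
have r_gt n : n.+1%:R^-1 <= r n.
  rewrite -[leLHS]lnK ?posrE ?invr_gt0 ?ltr0n// ler_expR lnV ?posrE ?ltr0n//.
  rewrite lerN2 ler_pdivrMr// ler_peMr ?ln_ge0 ?ler1n ?(leq_trans _ m4)//.
(* From [exp (-x) >= 1 - x] and [ln (n+2) - ln (n+1) <= 1/(n+1) <= 2/(n+2)]. *)
have rS n : r n * (1 - 2 / (m%:R * n.+2%:R)) <= r n.+1.
  have -> : r n.+1 = r n * expR (- ((ln n.+2%:R - ln n.+1%:R) / m%:R)).
    by rewrite -expRD; congr expR; field; rewrite gt_eqF.
  rewrite ler_wpM2l ?expR_ge0// (le_trans _ (expR_ge1Dx _))// lerD2l lerN2.
  rewrite -ler_pdivlMr; last by rewrite invr_gt0.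
  rewrite invrK invfM mulrA mulrAC divfK ?gt_eqF// (le_trans (ln_succ_le _ _))//.
  rewrite -[n.+1%:R^-1]mul1r ler_pdivrMr ?ltr0n// mulrAC ler_pdivlMr ?ltr0n//.
  by rewrite mul1r -natrM ler_nat; lia.
have bound n : u n.+1 <= D * r n.
  elim: n => [|n IHn].
    by rewrite /r ln1 mul0r oppr0 expR0 mulr1 /D le_max lexx.
  have C_D : C * m%:R <= D by rewrite /D le_max lexx orbT.
  have D0 : 0 <= D by rewrite (le_trans _ C_D)// mulr_ge0.
  have p1 : (0 : R) < n.+2%:R by rewrite ltr0n.
  rewrite (le_trans (uS _))// (le_trans _ (ler_wpM2l D0 (rS n)))//.
  have i0 : 0 < (n.+2%:R : R)^-1 by rewrite invr_gt0.
  have r1 : n.+2%:R^-1 <= r n.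
    by rewrite (le_trans _ (r_gt n))// lef_pV2 ?posrE ?ltr0n// ler_nat.
  have hk : 1 - k / n.+2%:R <= 1 - 4 / m%:R / n.+2%:R.
    by rewrite lerD2l lerN2 ler_wpM2r// ltW.
  have h4 : (0 : R) <= 1 - 4 / m%:R / n.+2%:R.
    rewrite subr_ge0 -mulrA -invfM ler_pdivrMr ?mulr_gt0// mul1r -natrM ler_nat.
    by rewrite (leq_trans m4)// leq_pmulr.
  apply: (@le_trans _ _ ((1 - 4 / m%:R / n.+2%:R) * (D * r n) + C / n.+2%:R ^+ 2)).
    by rewrite lerD2r (le_trans (ler_wpM2r (u0 _) hk))// ler_wpM2l.
  rewrite -exprVn invfM.
  have C_D' : C <= D * m%:R^-1 by rewrite ler_pdivlMr.
  set i : R := n.+2%:R^-1 in i0 r1 *; set q : R := m%:R^-1 in C_D' *.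
  have q0 : 0 < q by rewrite invr_gt0.
  (* Of the contraction [4/m], a share [2/m] pays for the decrease of [r] and a share [1/m] for this
     term. *)
  have : C * i ^+ 2 <= D * q * i * r n.
    have i0' := ltW i0; rewrite expr2 mulrA ler_pM ?mulr_ge0//.
    by rewrite ler_pM2r.
  have : 0 <= D * q * i * r n by rewrite !mulr_ge0 ?expR_ge0// ltW.
  lra.
(* Along [j^(2m)] the rate [n^(-1/m)] becomes [j^(-2)]. *)
exists (2 * m)%N, D => [|j]; first by rewrite muln_gt0 (leq_trans _ m4).
have e : (j.+1 ^ (2 * m) = (j.+1 ^ (2 * m)).-1.+1)%N by rewrite prednK// expn_gt0.
rewrite e (le_trans (bound _))// /r -e.
have -> : - (ln (j.+1 ^ (2 * m))%:R / m%:R) = ln (j.+1%:R^-1 ^+ 2 : R).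
  rewrite natrX !lnXn ?invr_gt0 ?ltr0n// lnV ?posrE ?ltr0n//.
  by rewrite -[_ *+ (2 * m)]mulr_natr -[_ *+ 2]mulr_natr natrM; field; rewrite gt_eqF.
by rewrite lnK ?posrE ?exprn_gt0 ?invr_gt0 ?ltr0n// exprVn.
Qed.

(** * Real-valued expectations and block sums *)

(** By monotone convergence the series of the [h k] has a finite integral, so it converges almost
    surely and its terms tend to zero. *)
Lemma ae_cvg0_of_sum_integral (R : realType) (d : measure_display)
    (T : measurableType d) (P : probability T R) (h : nat -> T -> R) (M : R)
    (h_meas : forall k, measurable_fun setT (h k))
    (h_ge0 : forall k w, 0 <= h k w)
    (h_sum : forall n,
       (\sum_(0 <= k < n) \int[P]_w (h k w)%:E <= M%:E)%E) :
  {ae P, forall w, h k w @[k --> \oo] --> (0 : R)}.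
Proof.
have mE k : measurable_fun setT (EFin \o h k).
  exact/measurable_EFinP.
have : P.-integrable setT (fun w => \sum_(0 <= k <oo) (h k w)%:E)%E.
  apply/integrableP; split.
    apply: (@ge0_emeasurable_sum _ _ _ _ (fun k w => (h k w)%:E) xpredT).
      by move=> k w _ _; rewrite lee_fin.
    by move=> k _; exact: mE.
  under eq_integral.
    move=> w _; rewrite gee0_abs; last first.
      by apply: nneseries_ge0 => k _ _; rewrite lee_fin.
    over.
  rewrite integral_nneseries//; last by move=> k w _; rewrite lee_fin.
  apply: (@le_lt_trans _ _ M%:E); last by rewrite ltry.
  apply: lime_le.
    apply: is_cvg_nneseries => k _ _.
    by apply: integral_ge0 => w _; rewrite lee_fin.
  by apply: nearW => n; exact: h_sum.
move=> /(integrable_ae measurableT).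
apply: filterS => w /(_ Logic.I) sfin.
apply: cvg_series_cvg_0; apply: nondecreasing_is_cvgn.
  apply/nondecreasing_seqP => n.
  by rewrite /series/= big_nat_recr//= lerDl.
exists (fine (\sum_(0 <= k <oo) (h k w)%:E)%E) => _ [n _ <-].
rewrite -lee_fin fineK// /series/= -sumEFin.
by apply: nneseries_lim_ge => k _ _; rewrite lee_fin.
Qed.

Section RealIntegrable.
Context (R : realType) (d : measure_display) (T : measurableType d)
  (P : probability T R).
Implicit Types h : T -> R.

Definition rintegrable h := P.-integrable setT (EFin \o h).

Lemma rintegrable_dominated (h1 h2 : T -> R) : measurable_fun setT h1 ->
  (forall w, `|h1 w| <= h2 w) -> rintegrable h2 -> rintegrable h1.
Proof.
move=> mh1 h12 ih2; apply: (le_integrable measurableT _ _ ih2).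
  exact/measurable_EFinP.
by move=> w _; rewrite lee_fin (le_trans (h12 w))// ler_norm.
Qed.

Lemma rintegrable_bounded h M : measurable_fun setT h ->
  (forall w, `|h w| <= M) -> rintegrable h.
Proof.
move=> mh hM; apply: (rintegrable_dominated (h2 := cst M)) => //.
exact: finite_measure_integrable_cst.
Qed.

Lemma rintegrableD (h1 h2 : T -> R) : rintegrable h1 -> rintegrable h2 ->
  rintegrable (fun w => h1 w + h2 w).
Proof. by move=> i1 i2; exact: (integrableD measurableT i1 i2). Qed.

Lemma rintegrableZ (k : R) h : rintegrable h ->
  rintegrable (fun w => k * h w).
Proof. by move=> i; exact: (integrableZl measurableT k i). Qed.

Lemma rintegrable_measurable h : rintegrable h -> measurable_fun setT h.
Proof. by move=> /measurable_int/measurable_EFinP. Qed.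

Lemma EFin_Rintegral h : rintegrable h ->
  (\int[P]_w (h w)%:E)%E = (\int[P]_w h w)%:E.
Proof. by move=> ih; rewrite fineK// integrable_fin_num. Qed.

Lemma Rintegral_probability_cst (c : R) : \int[P]_w c = c.
Proof. by rewrite Rintegral_cst//; have := probability_setT P; rewrite /= => ->; rewrite mulr1. Qed.

Lemma Rintegral_sum_le (s : seq nat) (h : nat -> T -> R) (c : nat -> R) :
  (forall i, rintegrable (h i)) -> (forall i, \int[P]_w h i w <= c i) ->
  rintegrable (fun w => \sum_(i <- s) h i w) /\
  \int[P]_w (\sum_(i <- s) h i w) <= \sum_(i <- s) c i.
Proof.
move=> ih hc; elim: s => [|i s [si sc]].
  have -> : (fun w => \sum_(i <- [::]) h i w) = cst 0.
    by apply/funext => w; rewrite big_nil.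
  split; last by rewrite big_nil Rintegral_probability_cst.
  by apply: (@rintegrable_bounded _ 0) => // w; rewrite normr0.
have -> : (fun w => \sum_(j <- i :: s) h j w) =
    (fun w => h i w + \sum_(j <- s) h j w).
  by apply/funext => w; rewrite big_cons.
split; first exact: rintegrableD.
by rewrite big_cons (RintegralD _ (ih i) si)// lerD.
Qed.

Lemma ae_cvg0_of_sum_Rintegral (h : nat -> T -> R) (M : R) :
  (forall k, rintegrable (h k)) -> (forall k w, 0 <= h k w) ->
  (forall n, \sum_(0 <= k < n) \int[P]_w h k w <= M) ->
  {ae P, forall w, h k w @[k --> \oo] --> (0 : R)}.
Proof.
move=> ih h0 hM; apply: (@ae_cvg0_of_sum_integral _ _ _ _ _ M) => // [k|n].
  exact: rintegrable_measurable.
under eq_bigr do rewrite EFin_Rintegral//.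
by rewrite sumEFin lee_fin.
Qed.

End RealIntegrable.

(** Cauchy-Schwarz with weights [c], by induction on the list. *)
Lemma sqr_weighted_sum_le (R : realType) (s : seq nat) (c z : nat -> R) :
  (forall i, 0 <= c i) ->
  (\sum_(i <- s) c i * z i) ^+ 2 <=
  (\sum_(i <- s) c i) * \sum_(i <- s) c i * z i ^+ 2.
Proof.
move=> c0; elim: s => [|i s IHs]; first by rewrite !big_nil expr0n mulr0.
rewrite !big_cons.
set B := \sum_(_ <- _) c _ * z _ in IHs *.
set S := \sum_(_ <- _) c _ in IHs *.
set Q := \sum_(_ <- _) c _ * _ in IHs *.
have S0 : 0 <= S by apply: sumr_ge0.
have Q0 : 0 <= Q by apply: sumr_ge0 => j _; rewrite mulr_ge0// sqr_ge0.
(* The induction hypothesis gives [(B z)^2 <= (S z^2) Q], and [4xy <= (x + y)^2]. *)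
have cross : 2 * (B * z i) <= S * z i ^+ 2 + Q.
  have [-|] := leP (B * z i) 0 => Bz.
    have : 0 <= S * z i ^+ 2 by rewrite mulr_ge0// sqr_ge0.
    lra.
  rewrite -ler_sqr ?nnegrE; last 2 first.
    lra.
    by rewrite addr_ge0// mulr_ge0// sqr_ge0.
  have := ler_wpM2r (sqr_ge0 (z i)) IHs.
  have := sqr_ge0 (S * z i ^+ 2 - Q).
  rewrite !expr2; lra.
have := ler_wpM2l (c0 i) cross; move: IHs; rewrite !expr2; lra.
Qed.

(** [j.+1] is the least index at which [N] exceeds [n]; monotonicity and [N k <= n] exclude that it
    is zero. *)
Lemma block_index (N : nat -> nat) (k n : nat) :
  {homo N : i j / (i < j)%N} -> (N k <= n)%N ->
  exists2 j, (k <= j)%N & (N j <= n < N j.+1)%N.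
Proof.
move=> Nlt Nkn.
have Nge i : (i <= N i)%N.
  by elim: i => // i IHi; rewrite (leq_ltn_trans IHi)// Nlt.
have Nle : {homo N : i j / (i <= j)%N}.
  by move=> i j; rewrite leq_eqVlt => /predU1P[->//|/Nlt/ltnW].
have ex : exists j, (n < N j)%N by exists n.+1; exact: Nge.
case: (ex_minnP ex) => -[|j] nj jmin.
  by move: (leq_ltn_trans Nkn nj); rewrite ltnNge Nle.
exists j; last first.
  by rewrite nj andbT leqNgt; apply/negP => /jmin; rewrite ltnn.
rewrite -ltnS ltnNge; apply/negP => /Nle jk.
by move: (leq_ltn_trans Nkn nj); rewrite ltnNge jk.
Qed.

(** Inside a block, [x] strays from its value at the left end by at most the block sum of [y], and
    [y n] is itself one nonnegative term of that sum. *)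
Lemma cvg_of_blocks (R : realType) (N : nat -> nat) (x y : nat -> R) :
  {homo N : i j / (i < j)%N} ->
  (forall n, `|x n.+1 - x n| <= y n) ->
  x (N k) @[k --> \oo] --> (0 : R) ->
  \sum_(N k <= i < N k.+1) y i @[k --> \oo] --> (0 : R) ->
  x n @[n --> \oo] --> (0 : R) /\ y n @[n --> \oo] --> (0 : R).
Proof.
move=> Nlt xy xN yN.
have y0 n : 0 <= y n by rewrite (le_trans _ (xy n)).
have path a n : (a <= n)%N -> `|x n - x a| <= \sum_(a <= i < n) y i.
  elim: n => [|n IHn].
    by rewrite leqn0 => /eqP->; rewrite subrr normr0 big_geq.
  rewrite leq_eqVlt => /predU1P[->|an]; first by rewrite subrr normr0 big_geq.
  rewrite big_nat_recr//= addrC.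
  by rewrite (le_trans _ (lerD (xy n) (IHn an)))// (le_trans _ (ler_normD _ _))// addrA subrK.
have sub a b n : (a <= n)%N -> (n <= b)%N ->
    \sum_(a <= i < n) y i <= \sum_(a <= i < b) y i.
  by move=> an nb; rewrite [leRHS](big_cat_nat an nb)/= lerDl sumr_ge0.
have key e : 0 < e -> exists k, forall n, (N k <= n)%N -> `|x n| < e /\ y n < e.
  move=> e0; have e2 : 0 < e / 2 by rewrite divr_gt0.
  move/cvgr0Pnorm_lt : xN => /(_ _ e2)[k1 _ hk1].
  move/cvgr0Pnorm_lt : yN => /(_ _ e2)[k2 _ hk2].
  exists (maxn k1 k2) => n /(block_index Nlt)[j].
  rewrite geq_max => /andP[/hk1/= xj /hk2/= yj] /andP[jn nj].
  have {}yj := le_lt_trans (ler_norm _) yj.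
  split.
    rewrite -(subrK (x (N j)) (x n)) (le_lt_trans (ler_normD _ _))//.
    have := path _ _ jn; have := sub _ _ _ jn (ltnW nj); lra.
  have : y n <= \sum_(N j <= i < N j.+1) y i.
    rewrite (le_trans _ (sub _ _ _ _ nj)) ?(leq_trans jn)//.
    by rewrite big_nat_recr//= lerDr sumr_ge0.
  lra.
split; apply/cvgr0Pnorm_lt => e /key[k hk]; exists (N k) => //= n /hk[]// _.
by rewrite ger0_norm.
Qed.

(** * Almost sure convergence from a drift condition in mean *)

(** The drift is assumed in plain expectation, which is enough to iterate the second moment of the
    error. [D n] is the increment before multiplication by the step size [1/(n+1)]. *)
Lemma ae_of_robbins_monro (R : realType) (d : measure_display)
    (T : measurableType d) (P : probability T R) (t D : nat -> T -> R)
    (theta k C : R) (theta_lt : `|theta| < 4^-1) (k_gt0 : 0 < k)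
    (t_meas : forall n, measurable_fun setT (t n))
    (D_meas : forall n, measurable_fun setT (D n))
    (t0_K : forall w, K (t 0%N w))
    (tS : forall n w, t n.+1 w = Defs.projK (t n w + D n w / n.+1%:R))
    (D_int : forall n, rintegrable P (fun w => D n w ^+ 2))
    (D_le : forall n, \int[P]_w (D n w ^+ 2) <= C)
    (drift : forall n, \int[P]_w ((t n w - theta) * D n w) <=
       - k * \int[P]_w ((t n w - theta) ^+ 2)) :
  {ae P, forall w, t n w @[n --> \oo] --> theta /\
    finite_set [set n | ~ K (t n w + D n w / n.+1%:R)]}.
Proof.
have theta_K : K theta.
  by rewrite /K/= in_itv/= -ler_norml ltW.
have t_K n w : K (t n w) by case: n => // n; rewrite tS; exact: projK_K.
have t_le n w : `|t n w - theta| <= 1.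
  move: (t_K n w) theta_K; rewrite /K/= !in_itv/= => /andP[? ?] /andP[? ?].
  by rewrite ler_norml; lra.
have tm n : measurable_fun setT (fun w => t n w - theta).
  exact: measurable_funB.
have t2_int n : rintegrable P (fun w => (t n w - theta) ^+ 2).
  apply: (@rintegrable_bounded _ _ _ _ _ 1); first exact: measurable_funX.
  by move=> w; rewrite normrX exprn_ile1.
(* With [|z| <= 1], the product [z d] is dominated by [1 + d^2]. *)
have tD_int n : rintegrable P (fun w => (t n w - theta) * D n w).
  apply: (@rintegrable_dominated _ _ _ _ _ (fun w => 1 + D n w ^+ 2)).
  - exact: measurable_funM.
  - move=> w; rewrite normrM (le_trans (ler_wpM2r (normr_ge0 _) (t_le n w)))//.
    rewrite mul1r -(real_normK (num_real (D n w))).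
    by have := sqr_ge0 (`|D n w| - 1); rewrite sqrrB !expr2; have := normr_ge0 (D n w); lra.
  - apply: rintegrableD => //; apply: (@rintegrable_bounded _ _ _ _ _ 1) => // w.
    by rewrite normr1.
pose u n := \int[P]_w ((t n w - theta) ^+ 2).
have u0 n : 0 <= u n by apply: Rintegral_ge0 => w _; exact: sqr_ge0.
have C0 : 0 <= C.
  by rewrite (le_trans _ (D_le 0%N))// Rintegral_ge0// => w _; exact: sqr_ge0.
(* Drop the projection and expand the square: the drift bounds the cross term, [D_le] the last
   one. *)
have uS n : u n.+1 <= (1 - (2 * k) / n.+1%:R) * u n + C / n.+1%:R ^+ 2.
  set i : R := n.+1%:R^-1.
  have i0 : 0 <= i by rewrite invr_ge0.
  have int1 : rintegrable P (fun w => (t n w - theta) ^+ 2 +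
      (2 * i) * ((t n w - theta) * D n w)).
    by apply: rintegrableD => //; exact: rintegrableZ.
  have int2 : rintegrable P (fun w => i ^+ 2 * D n w ^+ 2) by exact: rintegrableZ.
  apply: (@le_trans _ _ (\int[P]_w (((t n w - theta) ^+ 2 +
      (2 * i) * ((t n w - theta) * D n w)) + i ^+ 2 * D n w ^+ 2))).
    apply: le_Rintegral => //; [exact: t2_int | exact: rintegrableD |].
    move=> w _; rewrite tS -(real_normK (num_real (_ - theta))).
    apply: (@le_trans _ _ (`|t n w + D n w * i - theta| ^+ 2)).
      by rewrite ler_sqr ?nnegrE// projK_dist.
    by rewrite real_normK ?num_real// !expr2; lra.
  rewrite (RintegralD _ int1 int2)// (RintegralD _ (t2_int n))//; last exact: rintegrableZ.
  rewrite (RintegralZl (2 * i) _ (tD_int n))// (RintegralZl (i ^+ 2) _ (D_int n))//.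
  rewrite -/(u n) -exprVn -/i.
  have := ler_wpM2l i0 (drift n); rewrite -/(u n).
  have := ler_wpM2l (sqr_ge0 i) (D_le n).
  lra.
have k2 : 0 < 2 * k by rewrite mulr_gt0.
have [m [B m0 uB]] := rate_along_powers k2 C0 u0 uS.
pose N j := (j.+1 ^ m)%N.
have N_lt : {homo N : i j / (i < j)%N} by move=> i j ij; rewrite /N ltn_exp2r.
pose s j : R := \sum_(N j <= i < N j.+1) i.+1%:R^-1.
pose y w i := `|D i w| / i.+1%:R.
pose Q j w := \sum_(N j <= i < N j.+1) i.+1%:R^-1 * D i w ^+ 2.
have s0 j : 0 <= s j by apply: sumr_ge0 => i _; rewrite invr_ge0.
have [Q_int Q_le] : (forall j, rintegrable P (Q j)) /\
    (forall j, \int[P]_w Q j w <= s j * C).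
  apply/all_and2 => j; rewrite /s mulr_suml.
  apply: Rintegral_sum_le => i; first exact: rintegrableZ.
  by rewrite RintegralZl//; [rewrite ler_wpM2l// invr_ge0 | exact: D_int].
have aeN : {ae P, forall w, (t (N j) w - theta) ^+ 2 @[j --> \oo] --> (0 : R)}.
  apply: (@ae_cvg0_of_sum_Rintegral _ _ _ _ _ (B * 2)) => [j|j w|n].
  - exact: t2_int.
  - exact: sqr_ge0.
  have B0 : 0 <= B by have := le_trans (u0 _) (uB 0%N); rewrite expr1n divr1.
  rewrite (le_trans _ (ler_wpM2l B0 (sum_sqr_inv_le2 _ n)))// mulr_sumr ler_sum// => j _.
  by rewrite exprVn; exact: uB.
(* The mean is at most [C (s j)^2 <= C m^2/(j+1)^2], which is summable. *)
have aeQ : {ae P, forall w, s j * Q j w @[j --> \oo] --> (0 : R)}.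
  apply: (@ae_cvg0_of_sum_Rintegral _ _ _ _ _ (m%:R ^+ 2 * C * 2)) => [j|j w|n].
  - exact: rintegrableZ.
  - by rewrite mulr_ge0// sumr_ge0// => i _; rewrite mulr_ge0// sqr_ge0.
  have mC : 0 <= m%:R ^+ 2 * C by rewrite mulr_ge0// sqr_ge0.
  rewrite (le_trans _ (ler_wpM2l mC (sum_sqr_inv_le2 _ n)))// mulr_sumr ler_sum// => j _.
  rewrite RintegralZl//; last exact: Q_int.
  rewrite (le_trans (ler_wpM2l (s0 j) (Q_le j)))//.
  rewrite [leLHS]mulrA [leRHS]mulrAC ler_wpM2r// -exprMn expr2.
  by rewrite ler_pM// block_sum_inv_le.
apply: filterS2 aeN aeQ => w tN QN.
have tN' : t (N j) w - theta @[j --> \oo] --> (0 : R).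
  apply/cvgr0Pnorm_lt => e e0.
  move/cvgr0Pnorm_lt : tN => /(_ _ (exprn_gt0 2 e0)).
  apply: filterS => j; rewrite normrX ltr_pXn2r// nnegrE//; exact: ltW.
(* By Cauchy-Schwarz the square of this block sum is at most [s j * Q j w]. *)
have yN : \sum_(N j <= i < N j.+1) y w i @[j --> \oo] --> (0 : R).
  apply/cvgr0Pnorm_lt => e e0.
  move/cvgr0Pnorm_lt : QN => /(_ _ (exprn_gt0 2 e0)).
  apply: filterS => j; move=> /(le_lt_trans (ler_norm _)) Qe.
  rewrite -(ltr_pXn2r (ltn0Sn 1)) ?nnegrE//; last exact: ltW.
  rewrite real_normK ?num_real// (le_lt_trans _ Qe)//.
  have -> : Q j w = \sum_(N j <= i < N j.+1) i.+1%:R^-1 * `|D i w| ^+ 2.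
    by apply: eq_bigr => i _; rewrite real_normK ?num_real.
  rewrite (eq_bigr (fun i => i.+1%:R^-1 * `|D i w|)) => [|i _]; last exact: mulrC.
  exact: sqr_weighted_sum_le.
(* The current iterate lies in [K], so projecting does not lengthen the step. *)
have tstep n : `|(t n.+1 w - theta) - (t n w - theta)| <= y w n.
  rewrite opprB addrA subrK tS (le_trans (projK_dist _ (t_K n w)))//.
  by rewrite addrC addKr normrM [X in _ * X]ger0_norm// invr_ge0.
have [tcvg ycvg] := cvg_of_blocks N_lt tstep tN' yN.
have tcvg' : t n w @[n --> \oo] --> theta.
  exact/subr_cvg0.
split=> //.
(* Half the distance from [|theta|] to [1/4]: the error and the raw step eventually each stay below
   it, so the raw iterate stays in [K]. *)
have e0 : 0 < (4^-1 - `|theta|) / 2 by rewrite divr_gt0// subr_gt0.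
move/cvgr0Pnorm_lt : tcvg => /(_ _ e0)[n1 _ hn1].
move/cvgr0Pnorm_lt : ycvg => /(_ _ e0)[n2 _ hn2].
apply: (@sub_finite_set _ _ `I_(maxn n1 n2)) => // n /=; apply: contra_notP => /negP.
rewrite -leqNgt geq_max => /andP[/hn1/= h1 /hn2/= h2].
rewrite /K/= in_itv/= -ler_norml.
have {}h2 : `|D n w / n.+1%:R| < (4^-1 - `|theta|) / 2.
  by move: h2; rewrite !normrM normr_id.
rewrite (_ : _ + _ = (t n w - theta) + D n w / n.+1%:R + theta); last by ring.
have := ler_normD ((t n w - theta) + D n w / n.+1%:R) theta.
have := ler_normD (t n w - theta) (D n w / n.+1%:R).
lra.
Qed.

(** * Independence of the past and the next observation *)

Section Independence.
Context (R : realType) (d : measure_display) (T : measurableType d)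
  (P : probability T R).

(* The pi-lambda theorem, applied to the finite measures [P (. & C)] and
   [P C * P]. *)
Lemma independent_of_generator (G : set (set T)) (C : set T) :
  G `<=` measurable -> G setT -> setI_closed G -> measurable C ->
  (forall A, G A -> P (A `&` C) = (P A * P C)%E) ->
  forall A, <<s G >> A -> P (A `&` C) = (P A * P C)%E.
Proof.
move=> Gm GT GI mC GC A sA.
have PC : P C \is a fin_num by exact: fin_num_measure.
have r0 : 0 <= fine (P C) by exact/fine_ge0/measure_ge0.
have e B : mscale (NngNum r0) P B = (P B * P C)%E.
  by rewrite /mscale/= fineK// muleC.
rewrite -e.
apply: (g_sigma_algebra_measure_unique G Gm (fun=> setT) _ _
  (mrestr P mC) (mscale (NngNum r0) P)) => //.
- by rewrite bigcup_const.
- by move=> B GB; transitivity (P B * P C)%E; [exact: GC|exact/esym/e].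
- by move=> k; rewrite /= /mrestr setTI ltey_eq PC.
Qed.

(** [S] selects the indices already observed. Only generators are collected, so that the pasts of
    two families can be joined by a union. *)
Definition events_of (I : Type) (Z : I -> T -> R) (S : set I) : set (set T) :=
  [set A | exists i (B : set R), [/\ S i, measurable B & A = Z i @^-1` B]].

Lemma sigma_events_of_sub (I : Type) (Z : I -> T -> R) (S : set I) :
  <<s events_of Z S >> `<=` sigma_family Z.
Proof.
apply: sub_smallest2r; first exact: smallest_sigma_algebra.
by move=> A [i [B [_ mB ->]]]; exists i, B.
Qed.

Lemma sigma_family_measurable (I : Type) (Z : I -> T -> R) :
  (forall i, measurable_fun setT (Z i)) -> sigma_family Z `<=` measurable.
Proof.
move=> mZ; apply: smallest_sub; first exact: sigma_algebra_measurable.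
by move=> A [i [B [mB ->]]]; rewrite -[X in measurable X]setTI; exact: mZ.
Qed.

(** Finite intersections of events over [S] form a pi-system generating the past; on it the claim is
    the product formula for a finite index set enlarged by [i]. *)
Lemma mutually_independent_events (I : choiceType) (Z : I -> T -> R)
    (S : set I) (i : I) (B : set R) (A : set T) :
  (forall i, measurable_fun setT (Z i)) ->
  mutually_independent P Z -> ~ S i -> measurable B ->
  <<s events_of Z S >> A ->
  P (A `&` Z i @^-1` B) = (P A * P (Z i @^-1` B))%E.
Proof.
move=> mZ Zindep Si mB.
have mZB j C : measurable C -> measurable (Z j @^-1` C).
  by move=> mC; rewrite -[X in measurable X]setTI; exact: mZ.
pose G : set (set T) := [set A | exists (J : {fset I}) (C : I -> set R),
  [/\ [set` J] `<=` S, forall j, measurable (C j) &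
      A = \bigcap_(j in [set` J]) Z j @^-1` C j]].
have sG : <<s events_of Z S >> `<=` <<s G >>.
  apply: sub_smallest2r; first exact: smallest_sigma_algebra.
  move=> _ [j [C [Sj mC ->]]]; exists [fset j]%fset, (fun=> C); split=> //.
    by move=> k /=; rewrite inE => /eqP->.
  by rewrite set_fset1 bigcap_set1.
move=> /sG; apply: independent_of_generator.
- move=> _ [J [C [_ mC ->]]].
  by apply: fin_bigcap_measurable => // j _; exact: mZB.
- exists fset0, (fun=> setT); split=> //.
  by rewrite set_fset0 bigcap_set0.
- move=> _ _ [J1 [C1 [S1 m1 ->]]] [J2 [C2 [S2 m2 ->]]].
  (* An index absent from one of the two sets is left unconstrained there by [setT]. *)
  exists (J1 `|` J2)%fset, (fun j => (if j \in J1 then C1 j else setT) `&`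
    (if j \in J2 then C2 j else setT)); split.
  + by move=> j /=; rewrite inE => /orP[/S1|/S2].
  + by move=> j; apply: measurableI; case: ifPn.
  + apply/seteqP; split=> w /=.
      move=> [w1 w2] j /= _; split; case: ifPn => // jJ; [exact: w1|exact: w2].
    move=> wJ; split=> j /= jJ.
      by have /= := wJ j; rewrite inE jJ => /(_ isT)[].
    by have /= := wJ j; rewrite inE jJ orbT => /(_ isT)[].
- exact: mZB.
- move=> _ [J [C [SJ mC ->]]].
  have iJ : i \notin J by apply/negP => /SJ.
  (* The product formula is applied to [C'] over [J] with [i] added, and again over [J] alone. *)
  pose C' j := if j == i then B else C j.
  have mC' j : measurable (C' j) by rewrite /C'; case: ifPn.
  have e : forall j, j \in J -> Z j @^-1` C' j = Z j @^-1` C j.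
    move=> j jJ; rewrite /C'; case: eqVneq => // ji.
    by move: iJ; rewrite -ji jJ.
  have -> : \bigcap_(j in [set` J]) Z j @^-1` C j `&` Z i @^-1` B =
      \bigcap_(j in [set` (i |` J)%fset]) Z j @^-1` C' j.
    rewrite bigcap_fsetU1 setIC {1}/C' eqxx; congr (_ `&` _).
    by apply: eq_bigcapr => j /= jJ; rewrite e.
  rewrite Zindep// big_fsetU1//= Zindep// muleC /C' eqxx; congr (_ * _)%E.
  rewrite big_seq [RHS]big_seq; apply: eq_bigr => j jJ.
  by rewrite -/(C' j) e.
Qed.

(** Intersections [A1 & A2] of an event of each past form a generating pi-system. There,
    independence of the families detaches [A2], and independence within [U] separates [A1] from the
    new event. Times and noise take the role of [U] in turn. *)
Lemma independent_past_event (I J : choiceType) (U : I -> T -> R)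
    (V : J -> T -> R) (S : set I) (S' : set J) (i : I) (B : set R)
    (A : set T) :
  (forall i, measurable_fun setT (U i)) ->
  (forall j, measurable_fun setT (V j)) ->
  mutually_independent P U -> independent_families P U V ->
  ~ S i -> measurable B ->
  <<s events_of U S `|` events_of V S' >> A ->
  P (A `&` U i @^-1` B) = (P A * P (U i @^-1` B))%E.
Proof.
move=> mU mV Uindep UV Si mB.
have mUB : measurable (U i @^-1` B).
  by rewrite -[X in measurable X]setTI; exact: mU.
pose G : set (set T) := [set A | exists A1 A2,
  [/\ <<s events_of U S >> A1, <<s events_of V S' >> A2 & A = A1 `&` A2]].
have sT (H : set (set T)) : <<s H >> setT.
  exact: (@measurableT _ (g_sigma_algebraType H)).
have sG : <<s events_of U S `|` events_of V S' >> `<=` <<s G >>.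
  apply: sub_smallest2r; first exact: smallest_sigma_algebra.
  move=> C [UC|VC].
    by exists C, setT; split; [exact: sub_sigma_algebra|exact: sT|rewrite setIT].
  by exists setT, C; split; [exact: sT|exact: sub_sigma_algebra|rewrite setTI].
have sI (H : set (set T)) X Y : <<s H >> X -> <<s H >> Y -> <<s H >> (X `&` Y).
  exact: (@measurableI _ (g_sigma_algebraType H)).
move=> /sG; apply: independent_of_generator => //.
- move=> _ [A1 [A2 [s1 s2 ->]]]; apply: measurableI.
    exact: sigma_family_measurable mU _ (sigma_events_of_sub s1).
  exact: sigma_family_measurable mV _ (sigma_events_of_sub s2).
- by exists setT, setT; split; [exact: sT|exact: sT|rewrite setIT].
- move=> _ _ [A1 [A2 [s1 s2 ->]]] [B1 [B2 [t1 t2 ->]]].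
  exists (A1 `&` B1), (A2 `&` B2); split; [exact: sI|exact: sI|].
  by rewrite setIACA.
- move=> _ [A1 [A2 [s1 s2 ->]]].
  have UB : sigma_family U (U i @^-1` B).
    by apply: sub_sigma_algebra; exists i, B.
  rewrite setIAC UV; last 2 first.
  + exact: sI (sigma_events_of_sub s1) UB.
  + exact: sigma_events_of_sub s2.
  rewrite (UV A1 A2); last 2 first.
  + exact: sigma_events_of_sub s1.
  + exact: sigma_events_of_sub s2.
  rewrite (@mutually_independent_events _ _ S)//.
  by rewrite muleAC.
Qed.

End Independence.

(** * Expectation of a product of independent variables *)

Section ProductExpectation.
Context (R : realType) (d : measure_display) (T : measurableType d)
  (P : probability T R).

(** The law of the pair is the product of the two laws, and Fubini factors the integral; the bound
    on [h] makes the product integrable. *)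
Lemma expectationM_independent (h w : {RV P >-> R}) (M : R) :
  (forall A B : set R, measurable A -> measurable B ->
     P (h @^-1` A `&` w @^-1` B) = (P (h @^-1` A) * P (w @^-1` B))%E) ->
  (forall x, `|h x| <= M) -> rintegrable P w ->
  rintegrable P (fun x => h x * w x) /\
  \int[P]_x (h x * w x) = \int[P]_x h x * \int[P]_x w x.
Proof.
move=> hw hM iw.
have mh : measurable_fun setT h by [].
have mw : measurable_fun setT w by [].
have ih : rintegrable P h by exact: rintegrable_bounded hM.
have ihw : rintegrable P (fun x => h x * w x).
  apply: (rintegrable_dominated (h2 := fun x => M * `|w x|)).
  - exact: measurable_funM.
  - by move=> x; rewrite normrM ler_wpM2r.
  - apply: rintegrableZ; exact: integrable_norm.
split=> //; apply: EFin_inj.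
rewrite EFinM -!EFin_Rintegral//.
pose prodf (z : R * R) : \bar R := (z.1 * z.2)%:E.
have mprodf : measurable_fun setT prodf.
  apply/measurable_EFinP; apply: measurable_funM;
    [exact: measurable_fst|exact: measurable_snd].
have mpair : measurable_fun setT (fun x => (h x, w x)).
  exact: measurable_fun_pair.
pose mu1 := distribution P h.
pose mu2 := distribution P w.
have i1 : mu1.-integrable setT (EFin : R -> \bar R).
  exact: (integrable_pushforward (phi := h)).
have i2 : mu2.-integrable setT (EFin : R -> \bar R).
  exact: (integrable_pushforward (phi := w)).
have E1 : (\int[mu1]_x x%:E = \int[P]_x (h x)%:E)%E.
  by rewrite integral_distribution.
have E2 : (\int[mu2]_x x%:E = \int[P]_x (w x)%:E)%E.
  by rewrite integral_distribution.
(* By Tonelli, the iterated integral of [|x y|] is the product of two finite first moments. *)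
have iprod : (mu1 \x mu2)%E.-integrable setT prodf.
  apply/(integrable12ltyP _ _ mprodf) => /=.
  have /integrableP[_ f1] := i1; have /integrableP[_ f2] := i2.
  rewrite (eq_integral (fun x : R => `|x%:E| * \int[mu2]_y `|y%:E|)%E); last first.
    move=> x _; rewrite -ge0_integralZl//; last exact/measurable_EFinP.
    by apply: eq_integral => y _; rewrite /prodf/= normrM EFinM.
  rewrite ge0_integralZr//; last 2 first.
    exact/measurable_EFinP.
    by apply: integral_ge0.
  by rewrite lte_mul_pinfty// ?integral_ge0// ge0_fin_numE// integral_ge0.
transitivity (\int[pushforward P (fun x => (h x, w x))]_z prodf z)%E.
  rewrite integral_pushforward//.
transitivity (\int[mu1 \x mu2]_z prodf z)%E.
  apply: eq_measure_integral => /= A mA _.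
  (* Independence is exactly agreement with the product measure on rectangles. *)
  apply/esym/product_measure_unique => //= B C mB mC.
rewrite -integral12_prod_meas1// /fubini_F/=.
rewrite (eq_integral (fun x : R => x%:E * \int[mu2]_y y%:E)%E); last first.
  by move=> x _; rewrite -integralZl//.
have -> : (\int[mu2]_y y%:E = (\int[P]_x w x)%:E)%E.
  by rewrite E2 EFin_Rintegral.
by rewrite integralZr// E1 -EFin_Rintegral.
Qed.

End ProductExpectation.

(** * Integrals of periodic functions *)

Section BoundedMeasurable.
Context (R : realType) (d : measure_display) (T : measurableType d).
Implicit Types F G : T -> R.

(** A class stable under sums, products and measurable substitutions, and integrable on every
    measurable set of finite measure; it spares separate integrability proofs. *)
Definition bounded_measurable F :=
  measurable_fun setT F /\ exists M, forall x, `|F x| <= M.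

Lemma bounded_measurable_cst (c : R) : bounded_measurable (fun=> c).
Proof. by split=> //; exists `|c|. Qed.

Lemma bounded_measurableD F G : bounded_measurable F -> bounded_measurable G ->
  bounded_measurable (fun x => F x + G x).
Proof.
move=> [mF [M FM]] [mG [N GN]]; split; first exact: measurable_funD.
by exists (M + N) => x; rewrite (le_trans (ler_normD _ _))// lerD.
Qed.

Lemma bounded_measurableM F G : bounded_measurable F -> bounded_measurable G ->
  bounded_measurable (fun x => F x * G x).
Proof.
move=> [mF [M FM]] [mG [N GN]]; split; first exact: measurable_funM.
by exists (M * N) => x; rewrite normrM ler_pM.
Qed.

Lemma bounded_measurable_integrable (mu : {measure set T -> \bar R}) F
    (D : set T) :
  measurable D -> (mu D < +oo)%E -> bounded_measurable F ->
  mu.-integrable D (EFin \o F).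
Proof.
move=> mD muD [mF [M FM]]; apply: measurable_bounded_integrable => //.
  exact: measurable_funTS.
by exists M; split; [exact: num_real|move=> x Mx y _ /=; rewrite (le_trans (FM y))// ltW].
Qed.

End BoundedMeasurable.

Lemma bounded_measurable_comp (R : realType) (d d' : measure_display)
    (T : measurableType d) (T' : measurableType d') (F : T -> R) (h : T' -> T) :
  bounded_measurable F -> measurable_fun setT h ->
  bounded_measurable (fun x => F (h x)).
Proof.
move=> [mF [M FM]] mh; split; first exact: measurableT_comp.
by exists M => x; exact: FM.
Qed.

Section PeriodicIntegral.
Context (R : realType).
Local Notation mu := (@lebesgue_measure R).

Lemma bounded_measurable_sin (b c : R) :
  bounded_measurable (fun x : R => sin (b * x + c)).
Proof.
split; last first.
  by exists 1 => x; rewrite ler_norml sin_geN1 sin_le1.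
apply: measurableT_comp.
  apply: continuous_measurable_fun. exact: continuous_sin.
by apply: measurable_funD => //; exact: measurable_funM.
Qed.

Lemma lebesgue_measure_itv_lty (b1 b2 : bool) (x y : R) :
  (mu [set` Interval (BSide b1 x) (BSide b2 y)] < +oo)%E.
Proof.
by rewrite lebesgue_measure_itv /=; case: ifPn => // _; rewrite -EFinB ltry.
Qed.

Lemma bounded_measurable_integrable_itv (F : R -> R) (b1 b2 : bool) (x y : R) :
  bounded_measurable F ->
  mu.-integrable [set` Interval (BSide b1 x) (BSide b2 y)] (EFin \o F).
Proof.
move=> bF; exact: (@bounded_measurable_integrable R _ _ mu F _
  (measurable_itv _) (lebesgue_measure_itv_lty b1 b2 x y) bF).
Qed.

(** The image of Lebesgue measure under a translation agrees with it on half-open intervals, which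
    determine it. *)
Lemma lebesgue_measure_addr (s : R) (A : set R) : measurable A ->
  mu ((fun x => x + s) @^-1` A) = mu A.
Proof.
move=> mA.
have ms : measurable_fun setT
    ((fun x => x + s) : measurableTypeR R -> measurableTypeR R).
  exact: measurable_funD.
apply/esym.
pose shift : {mfun measurableTypeR R >-> measurableTypeR R} :=
  HB.pack (fun x : R => x + s) (isMeasurableFun.Build _ _ _ _ _ ms).
apply: (lebesgue_measure_unique (mu := pushforward mu shift)) => //= _ [[a b]] _ <-.
rewrite /pushforward.
have -> : shift @^-1` `]a, b]%classic = `]a - s, b - s]%classic.
  by apply/seteqP; split=> x /=; rewrite !in_itv/= ltrBlDr lerBrDr.
rewrite !lebesgue_measure_itv/= !lte_fin ltrD2r -!EFinD.
by rewrite opprB addrA subrK.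
Qed.

(** A general map [phi] covers both the translations and the reflection used below. *)
Lemma Rintegral_measure_preserving (phi F : R -> R) (D : set R) :
  measurable_fun setT phi ->
  (forall A, measurable A -> mu (phi @^-1` A) = mu A) ->
  measurable D -> (mu D < +oo)%E -> bounded_measurable F ->
  \int[mu]_(x in phi @^-1` D) F (phi x) = \int[mu]_(x in D) F x.
Proof.
move=> mphi phiE mD Dfin bF; congr fine.
have mD' : measurable (phi @^-1` D) by rewrite -[X in measurable X]setTI; exact: mphi.
have mF : measurable_fun setT (EFin \o F : measurableTypeR R -> \bar R).
  by apply/measurable_EFinP; case: bF.
have iF : mu.-integrable (phi @^-1` D) ((EFin \o F) \o phi).
  have D'fin : (mu (phi @^-1` D) < +oo)%E by rewrite phiE.
  exact: (@bounded_measurable_integrable R _ _ mu (fun x => F (phi x)) _ mD' D'fin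
    (bounded_measurable_comp bF mphi)).
rewrite -(@integral_pushforward _ _ (measurableTypeR R) (measurableTypeR R) R
  phi mphi mu D (EFin \o F) mF iF mD).
by apply: eq_measure_integral => A mA _; exact: phiE.
Qed.

(** Both windows contain [[c', c + 1]]; what remains of each is a translate by one period of what
    remains of the other. *)
Lemma Rintegral_period (F : R -> R) (c c' : R) :
  bounded_measurable F -> periodic F 1 -> c <= c' <= c + 1 ->
  \int[mu]_(x in `[c, c + 1]) F x = \int[mu]_(x in `[c', c' + 1]) F x.
Proof.
move=> bF F1 /andP[cc' c'c].
have int b1 b2 (x y : R) : mu.-integrable
    [set` Interval (BSide b1 x) (BSide b2 y)] (EFin \o F).
  exact: bounded_measurable_integrable_itv.
have E1 := @Rintegral_itvB _ F (BLeft c) (BRight (c + 1)) c' (int _ _ _ _).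
have E2 := @Rintegral_itvB _ F (BLeft c') (BRight (c' + 1)) (c + 1) (int _ _ _ _).
have {}E1 := E1 ltac:(by rewrite bnd_simp) ltac:(by rewrite bnd_simp).
have {}E2 := E2 ltac:(by rewrite bnd_simp) ltac:(by rewrite bnd_simp lerD2r).
have E3 : \int[mu]_(x in `]c + 1, c' + 1]) F x = \int[mu]_(x in `]c, c']) F x.
  rewrite -(@Rintegral_measure_preserving (fun x => x + 1))//.
  - have -> : (fun x : R => x + 1) @^-1` `]c + 1, c' + 1]%classic = `]c, c']%classic.
      by apply/seteqP; split=> x /=; rewrite !in_itv/= ltrD2r lerD2r.
    by apply: eq_Rintegral => x _; rewrite F1.
  - exact: measurable_funD.
  - exact: lebesgue_measure_addr.
  - exact: lebesgue_measure_itv_lty.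
have E4 := @Rintegral_itv_obnd_cbnd _ c (BRight c') F (int _ _ _ _).
have E5 := @Rintegral_itv_obnd_cbnd _ c' (BRight (c + 1)) F (int _ _ _ _).
rewrite E5 in E1; rewrite E3 E4 in E2; lra.
Qed.

(** Translation moves the window by [s], and periodicity moves it back. The sign of [s] decides
    which window is the left one. *)
Lemma Rintegral_periodic_shift (F : R -> R) (s : R) :
  bounded_measurable F -> periodic F 1 -> `|s| <= 1 ->
  \int[mu]_(x in `[- 2^-1, 2^-1]) F (x + s) =
  \int[mu]_(x in `[- 2^-1, 2^-1]) F x.
Proof.
move=> bF F1; rewrite ler_norml => /andP[s1 s2].
have half : (2^-1 : R) = - 2^-1 + 1 by lra.
have e : `[- 2^-1, 2^-1]%classic =
    (fun x : R => x + s) @^-1` `[- 2^-1 + s, (- 2^-1 + s) + 1]%classic.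
  apply/seteqP; split=> x /=; rewrite !in_itv/=; lra.
rewrite {1}e Rintegral_measure_preserving//; last first.
- exact: lebesgue_measure_itv_lty.
- exact: lebesgue_measure_addr.
- exact: measurable_funD.
rewrite (_ : `[- 2^-1, 2^-1] = `[- 2^-1, - 2^-1 + 1] :> interval R); last by rewrite -half.
have [s0|s0] := leP 0 s.
  by apply/esym/Rintegral_period => //; lra.
by apply: Rintegral_period => //; lra.
Qed.

(** Reflection shows that the integral equals its opposite. *)
Lemma Rintegral_odd (F : R -> R) :
  bounded_measurable F -> (forall x, F (- x) = - F x) ->
  \int[mu]_(x in `[- 2^-1, 2^-1]) F x = 0.
Proof.
move=> bF oF.
have : \int[mu]_(x in `[- 2^-1, 2^-1]) F x = \int[mu]_(x in `[- 2^-1, 2^-1]) (-1 * F x).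
  rewrite -[LHS](@Rintegral_measure_preserving -%R)//.
  - have -> : -%R @^-1` `[- 2^-1, 2^-1]%classic = `[(- 2^-1 : R), 2^-1]%classic.
      by apply/seteqP; split=> x /=; rewrite !in_itv/=; lra.
    by apply: eq_Rintegral => x _; rewrite oF mulN1r.
  - by move=> A mA; exact: lebesgue_measureN.
  - exact: lebesgue_measure_itv_lty.
rewrite RintegralZl//; last exact: bounded_measurable_integrable_itv.
lra.
Qed.

End PeriodicIntegral.

(** * Expectations computed through a density *)

Section Density.
Context (R : realType) (d : measure_display) (T : measurableType d)
  (P : probability T R).
Local Notation mu := (@lebesgue_measure R).

(** The law of [Z] is absolutely continuous, so the Radon-Nikodym change of variables applies once
    the derivative is identified with [g] restricted to [D]. *)
Lemma Rintegral_density (Z : {RV P >-> R}) (D : set R) (g phi : R -> R) :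
  measurable D -> has_density_on Z D g -> measurable_fun setT g ->
  bounded_measurable phi ->
  \int[P]_w phi (Z w) = \int[mu]_(x in D) (phi x * g x).
Proof.
move=> mD Zg mg bphi; congr fine.
have mZ : measurable_fun setT (Z : T -> measurableTypeR R).
  exact: (@measurable_funPT _ _ _ _ Z).
pose Z' : {mfun T >-> measurableTypeR R} :=
  HB.pack (Z : T -> measurableTypeR R) (isMeasurableFun.Build _ _ _ _ _ mZ).
pose nu := distribution P Z'.
have nuE B : measurable B -> nu B = (\int[mu]_(x in B) ((EFin \o g) \_ D) x)%E.
  by move=> mB; transitivity (distribution P Z B) => //; rewrite Zg// -integral_mkcondr.
have mgD : measurable_fun setT ((EFin \o g) \_ D : measurableTypeR R -> \bar R).
  apply/(measurable_restrictT _ _).1 => //.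
  by apply: measurable_funTS; exact/measurable_EFinP.
have numu : nu `<< mu.
  apply/null_content_dominatesP => A mA A0; rewrite nuE//.
  by apply: null_set_integral => //; exact: measurable_funTS.
have bphiZ := bounded_measurable_comp bphi (@measurable_funPT _ _ _ _ Z).
have iphiZ : P.-integrable setT (EFin \o (fun w => phi (Z w))).
  apply: bounded_measurable_integrable => //.
  by rewrite ltey_eq fin_num_measure.
have mphi : measurable_fun setT (EFin \o phi : measurableTypeR R -> \bar R).
  by apply/measurable_EFinP; case: bphi.
have iphi : nu.-integrable setT (EFin \o phi).
  exact: (integrable_pushforward (phi := Z')).
transitivity (\int[nu]_x (phi x)%:E)%E.
  by rewrite (integral_distribution (X := Z')).
rewrite -(Radon_Nikodym_change_of_variables numu measurableT iphi).
(* Both functions have the same integral over every measurable set. *)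
have RNE : ae_eq mu setT (Radon_Nikodym (charge_of_finite_measure nu) mu) ((EFin \o g) \_ D).
  apply: integral_ae_eq => //.
    exact: Radon_Nikodym_integrable.
  by move=> E _ mE; rewrite -Radon_Nikodym_integral//; exact: nuE.
transitivity (\int[mu]_x ((EFin \o phi) x * ((EFin \o g) \_ D) x))%E.
  apply: ae_eq_integral => //.
  - by apply: emeasurable_funM.
  - by apply: emeasurable_funM.
  - exact: ae_eqe_mul2l.
rewrite [RHS]integral_mkcond; apply: eq_integral => x _.
by rewrite !patchE; case: ifPn => // _; rewrite mule0.
Qed.

End Density.

(** * The mean of one step *)

Section ShapeMoment.
Context (R : realType).
Local Notation mu := (@lebesgue_measure R).

Lemma sin_half_period (b : R) : sin (b + pi) = - sin b.
Proof. by rewrite sinD cospi sinpi; ring. Qed.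

Lemma sin_add_2pi (b : R) : sin (b + 2 * pi) = sin b.
Proof. by rewrite mulr_natl sinD2pi. Qed.

(** By periodicity [x - theta] becomes the variable. Expanding the sine leaves a cosine against [f],
    which is the Fourier coefficient, an odd term, and the constant [v] against a full sine wave;
    the last two integrate to zero. *)
Lemma Rintegral_sin_shape (f : R -> R) (theta a v c : R) :
  bounded_measurable f -> (forall x, f (- x) = f x) -> periodic f 1 ->
  `|theta| <= 1 ->
  \int[mu]_(x in `[- 2^-1, 2^-1])
     (sin (2 * pi * x + c) * (a * f (x - theta) + v)) =
  a * sin (2 * pi * theta + c) * fourier1 f.
Proof.
move=> bf f_even f_per theta1.
have bsin b : bounded_measurable (fun x : R => sin (2 * pi * x + b)).
  exact: bounded_measurable_sin.
have sin_per b : periodic (fun x : R => sin (2 * pi * x + b)) 1.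
  by move=> x; rewrite /= mulrDr mulr1 addrAC sin_add_2pi.
pose S u := sin (2 * pi * u + (2 * pi * theta + c)) * (a * f u + v).
have bS : bounded_measurable S.
  apply: bounded_measurableM => //; apply: bounded_measurableD.
    by apply: bounded_measurableM => //; exact: bounded_measurable_cst.
  exact: bounded_measurable_cst.
have S_per : periodic S 1 by move=> x; rewrite /S f_per sin_per.
transitivity (\int[mu]_(x in `[- 2^-1, 2^-1]) S (x - theta)).
  apply: eq_Rintegral => x _; rewrite /S; congr (sin _ * _); ring.
rewrite (Rintegral_periodic_shift bS S_per); last by rewrite normrN.
(* The cosine is written as a shifted sine, so that one boundedness lemma serves all three terms. *)
pose S1 u := sin (2 * pi * u + pi / 2) * f u.
pose S2 u := sin (2 * pi * u + 0) * f u.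
pose S3 u := sin (2 * pi * u + (2 * pi * theta + c)).
have bS1 : bounded_measurable S1 by exact: bounded_measurableM.
have bS2 : bounded_measurable S2 by exact: bounded_measurableM.
have bS3 : bounded_measurable S3 by exact: bounded_measurable_sin.
have bZ (k : R) (F : R -> R) : bounded_measurable F ->
    bounded_measurable (fun x => k * F x).
  by move=> bF; apply: bounded_measurableM => //; exact: bounded_measurable_cst.
have I F := @bounded_measurable_integrable_itv R F true false (- 2^-1) 2^-1.
have -> : \int[mu]_(x in `[- 2^-1, 2^-1]) S x = \int[mu]_(x in `[- 2^-1, 2^-1])
    (a * sin (2 * pi * theta + c) * S1 x +
     (a * cos (2 * pi * theta + c) * S2 x + v * S3 x)).
  apply: eq_Rintegral => x _; rewrite /S /S1 /S2 /S3 sinDpihalf addr0 sinD; ring.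
rewrite RintegralD//; last 2 first.
- exact/I/bZ.
- by apply: I; apply: bounded_measurableD; exact: bZ.
rewrite RintegralD//; last 2 first.
- exact/I/bZ.
- exact/I/bZ.
rewrite !RintegralZl//; last 3 first.
- exact: I.
- exact: I.
- exact: I.
have -> : \int[mu]_(x in `[- 2^-1, 2^-1]) S2 x = 0.
  apply: Rintegral_odd => // x.
  by rewrite /S2 !addr0 f_even mulrN sinN mulNr.
(* A shift by half a period changes the sign of the sine but not its integral. *)
have -> : \int[mu]_(x in `[- 2^-1, 2^-1]) S3 x = 0.
  have : \int[mu]_(x in `[- 2^-1, 2^-1]) S3 (x + 2^-1) =
      \int[mu]_(x in `[- 2^-1, 2^-1]) (- 1 * S3 x).
    apply: eq_Rintegral => x _; rewrite /S3 mulN1r -sin_half_period.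
    by congr sin; field.
  rewrite RintegralZl//; last exact: I.
  rewrite (Rintegral_periodic_shift bS3 (sin_per _)); last by rewrite ger0_norm; lra.
  lra.
rewrite !mulr0 !addr0; congr (_ * _).
by rewrite /fourier1; apply: eq_Rintegral => x _; rewrite /S1 sinDpihalf.
Qed.

End ShapeMoment.

(** * The recursion for one coordinate *)

(** The sigma-algebra on [T] is arbitrary: the lemma is applied to the ambient one and to those
    generated by past data. Only data of index below [n] enter [t n]. *)
Lemma measurable_recursion (R : realType) (d : measure_display)
    (T : measurableType d) (f g : R -> R) (a theta v s t0 : R)
    (x e t : nat -> T -> R) (n : nat) :
  measurable_fun setT f -> measurable_fun setT (fun y => (g y)^-1) ->
  (forall w, t 0%N w = t0) ->
  (forall k w, t k.+1 w = Defs.projK (t k w +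
     s * (sin (2 * pi * (x k w - t k w)) / g (x k w) *
          (a * f (x k w - theta) + v + e k w)) / k.+1%:R)) ->
  (forall k, (k < n)%N -> measurable_fun setT (x k)) ->
  (forall k, (k < n)%N -> measurable_fun setT (e k)) ->
  measurable_fun setT (t n).
Proof.
move=> mf mg t0E tS; elim: n => [|n IHn] mx me.
  by rewrite (_ : t 0%N = fun=> t0)//; apply/funext.
have {}IHn : measurable_fun setT (t n).
  by apply: IHn => k kn; [apply: mx|apply: me]; rewrite ltnS ltnW.
have mxn := mx n (ltnSn n); have men := me n (ltnSn n).
have -> : t n.+1 = fun w => Defs.projK (t n w +
     s * (sin (2 * pi * (x n w - t n w)) / g (x n w) *
          (a * f (x n w - theta) + v + e n w)) / n.+1%:R).
  by apply/funext => w; exact: tS.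
apply: (measurableT_comp (@measurable_projK R)).
apply: measurable_funD => //; apply: measurable_funM => //.
apply: measurable_funM => //; apply: measurable_funM.
  apply: measurable_funM; last exact: (measurableT_comp mg).
  apply: (@measurableT_comp _ _ _ _ _ _ (@sin R)).
    by apply: continuous_measurable_fun; exact: continuous_sin.
  by apply: measurable_funM => //; exact: measurable_funB.
apply: measurable_funD => //; apply: measurable_funD => //.
apply: measurable_funM => //; apply: (measurableT_comp mf).
exact: measurable_funB.
Qed.

Lemma independent_families_sym (R : realType) (d : measure_display)
    (T : measurableType d) (P : probability T R) (I J : Type)
    (Z : I -> T -> R) (W : J -> T -> R) :
  independent_families P Z W -> independent_families P W Z.
Proof. by move=> ZW A B sA sB; rewrite setIC ZW// muleC. Qed.

(** [h] is measurable for the sigma-algebra of the past, so its preimages are past events,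
    independent of [U i]. This takes the place of a conditional expectation. *)
Lemma independent_past_expectation (R : realType) (d : measure_display)
    (T : measurableType d) (P : probability T R) (I J : choiceType)
    (U : I -> {RV P >-> R}) (V : J -> {RV P >-> R}) (S : set I) (S' : set J)
    (i : I) (h : T -> R) (phi : R -> R) :
  mutually_independent P (fun i => U i : T -> R) ->
  independent_families P (fun i => U i : T -> R) (fun j => V j : T -> R) ->
  ~ S i ->
  measurable_fun setT (h : g_sigma_algebraType
    (events_of (fun i => U i : T -> R) S `|`
     events_of (fun j => V j : T -> R) S') -> R) ->
  bounded_measurable h -> measurable_fun setT phi ->
  rintegrable P (phi \o U i) ->
  rintegrable P (fun w => h w * phi (U i w)) /\
  \int[P]_w (h w * phi (U i w)) = \int[P]_w h w * \int[P]_w phi (U i w).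
Proof.
move=> Uindep UV Si hpast [mh [M hM]] mphi iphi.
have mphiU : measurable_fun setT (phi \o U i) by exact: measurableT_comp.
pose h' : {RV P >-> R} := HB.pack h (isMeasurableFun.Build _ _ _ _ _ mh).
pose w' : {RV P >-> R} :=
  HB.pack (phi \o U i) (isMeasurableFun.Build _ _ _ _ _ mphiU).
apply: (@expectationM_independent _ _ _ _ h' w' M) => // A B mA mB.
have mB' : measurable (phi @^-1` B).
  by rewrite -[X in measurable X]setTI; exact: mphi.
apply: (@independent_past_event _ _ _ _ _ _ _ _ S S' _ _ _ _ _ Uindep UV Si mB') => //.
by rewrite -[X in smallest _ _ X]setTI; exact: hpast.
Qed.

Lemma measurable_past (R : realType) (d : measure_display)
    (T : measurableType d) (I : Type) (Z : I -> T -> R) (S : set I) (i : I)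
    (G : set (set T)) :
  S i -> events_of Z S `<=` G ->
  measurable_fun setT (Z i : g_sigma_algebraType G -> R).
Proof.
move=> Si SG _ B mB; rewrite setTI; apply: sub_sigma_algebra.
by apply: SG; exists i, B.
Qed.

Section ScalarRecursion.
Context (R : realType) (d : measure_display) (T : measurableType d)
  (P : probability T R) (J : choiceType).
(** [E] is the noise of all coordinates, whose independence is joint, and [i_] picks that of the
    coordinate at hand. Index [n] refers to the data that lead from [t n] to [t n.+1]. *)
Variables (X : nat -> {RV P >-> R}) (E : J -> {RV P >-> R}) (i_ : nat -> J).
Variables (f g : R -> R) (a theta v t0 delta sigma2 : R).
Variable t : nat -> T -> R.
Hypothesis i_inj : injective i_.
Hypothesis X_indep : mutually_independent P (fun n => X n : T -> R).
Hypothesis E_indep : mutually_independent P (fun j => E j : T -> R).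
Hypothesis E_X_indep :
  independent_families P (fun j => E j : T -> R) (fun n => X n : T -> R).
Hypothesis X_density : forall n, has_density_on (X n) `[- 2^-1, 2^-1] g.
Hypothesis g_cont : continuous g.
Hypothesis delta_gt0 : 0 < delta.
Hypothesis g_ge : forall x, delta <= g x.
Hypothesis bf : bounded_measurable f.
Hypothesis f_even : forall x, f (- x) = f x.
Hypothesis f_per : periodic f 1.
Hypothesis f1_neq0 : a * fourier1 f != 0.
Hypothesis theta_lt : `|theta| < 4^-1.
Hypothesis E_int : forall n, rintegrable P (E (i_ n)).
Hypothesis E_mean : forall n, \int[P]_w E (i_ n) w = 0.
Hypothesis E2_int : forall n, rintegrable P (fun w => E (i_ n) w ^+ 2).
Hypothesis E2_le : forall n, \int[P]_w (E (i_ n) w ^+ 2) <= sigma2.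
Hypothesis t0_K : K t0.
Let s := Num.sg (a * fourier1 f).
Let D n w := s * (sin (2 * pi * (X n w - t n w)) / g (X n w) *
  (a * f (X n w - theta) + v + E (i_ n) w)).
Hypothesis t_0 : forall w, t 0%N w = t0.
Hypothesis tS : forall n w, t n.+1 w = Defs.projK (t n w + D n w / n.+1%:R).

Let g_gt0 x : 0 < g x. Proof. exact: lt_le_trans (g_ge x). Qed.

Let mg : measurable_fun setT g. Proof. exact: continuous_measurable_fun. Qed.

Let binvg : bounded_measurable (fun x : R => (g x)^-1).
Proof.
split; last first.
  exists delta^-1 => x; rewrite ger0_norm ?invr_ge0 ?(ltW (g_gt0 _))//.
  by rewrite lef_pV2 ?posrE.
apply: continuous_measurable_fun => x.
by apply: cvgV; [rewrite gt_eqF | exact: g_cont].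
Qed.

Let tK n w : K (t n w).
Proof. by case: n => [|n]; rewrite ?t_0// tS; exact: projK_K. Qed.

Let bX (F : R -> R) n : bounded_measurable F -> bounded_measurable (F \o X n).
Proof. by move=> bF; apply: (bounded_measurable_comp bF). Qed.

Let brint (F : T -> R) : bounded_measurable F -> rintegrable P F.
Proof. by move=> [mF [M FM]]; exact: rintegrable_bounded FM. Qed.

Let bshift : bounded_measurable (fun x : R => a * f (x - theta) + v).
Proof.
apply: bounded_measurableD; last exact: bounded_measurable_cst.
apply: bounded_measurableM; first exact: bounded_measurable_cst.
by apply: (bounded_measurable_comp bf); exact: measurable_funB.
Qed.

(** The phases [c = 0] and [c = pi/2] give the sine and the cosine into which [sin (2 pi (X - t))]
    separates. *)
Let psi (c x : R) := sin (2 * pi * x + c) / g x.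

Let bpsi c : bounded_measurable (psi c).
Proof. by apply: bounded_measurableM => //; exact: bounded_measurable_sin. Qed.

Let W c n w := psi c (X n w) * (a * f (X n w - theta) + v) +
  psi c (X n w) * E (i_ n) w.

(** [h] is the identity in every use; it lets the sample space carry a smaller sigma-algebra. *)
Let t_past n d' (T' : measurableType d') (h : T' -> T) :
  (forall k, (k < n)%N -> measurable_fun setT (X k \o h)) ->
  (forall k, (k < n)%N -> measurable_fun setT (E (i_ k) \o h)) ->
  measurable_fun setT (t n \o h).
Proof.
apply: (@measurable_recursion R d' T' f g a theta v s t0
  (fun k => X k \o h) (fun k => E (i_ k) \o h) (fun k => t k \o h)).
- by case: bf.
- by case: binvg.
- by move=> w /=; rewrite t_0.
- by move=> k w /=; rewrite tS.
Qed.

Let tm n : measurable_fun setT (t n).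
Proof. exact: (@t_past n _ T id). Qed.

(** A bound on [K] is enough, since the iterates never leave [K]. *)
Let bH (F : R -> R) n : measurable_fun setT F ->
  (forall x, K x -> `|F x| <= 1) -> bounded_measurable (fun w => F (t n w)).
Proof.
move=> mF F1; split; first exact: measurableT_comp.
by exists 1 => w; exact/F1/tK.
Qed.

(* The observation time is independent of the past, and the noise is centred
   and independent of both, hence the two applications below. *)
Let score_mean c n (F : R -> R) : measurable_fun setT F ->
  (forall x, K x -> `|F x| <= 1) ->
  rintegrable P (fun w => F (t n w) * W c n w) /\
  \int[P]_w (F (t n w) * W c n w) =
  \int[P]_w F (t n w) * (a * sin (2 * pi * theta + c) * fourier1 f).
Proof.
move=> mF F1; have bF := bH n mF F1.
pose phi (x : R) := psi c x * (a * f (x - theta) + v).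
have bphi : bounded_measurable phi by exact: bounded_measurableM.
have [i1 e1] : rintegrable P (fun w => F (t n w) * phi (X n w)) /\
    \int[P]_w (F (t n w) * phi (X n w)) =
    \int[P]_w F (t n w) * \int[P]_w phi (X n w).
  apply: (@independent_past_expectation _ _ _ _ _ _ X E `I_n (i_ @` `I_n)
    n (fun w => F (t n w)) phi X_indep (independent_families_sym E_X_indep)) => //.
  - by rewrite /= ltnn.
  - apply: (measurableT_comp mF).
    apply: (@t_past n _ (g_sigma_algebraType
        (events_of (fun i : nat => X i : T -> R) `I_n `|`
         events_of (fun j : J => E j : T -> R) (i_ @` `I_n))) id) => k kn.
      apply: (measurable_past (Z := fun k => X k : T -> R) (S := `I_n)) => //.
    apply: (measurable_past (Z := fun k => E k : T -> R) (S := i_ @` `I_n)).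
      by exists k.
    exact: subsetUr.
  - by case: bphi.
  - exact/brint/bX.
have [i2 e2] : rintegrable P (fun w => (F (t n w) * psi c (X n w)) * E (i_ n) w) /\
    \int[P]_w ((F (t n w) * psi c (X n w)) * E (i_ n) w) =
    \int[P]_w (F (t n w) * psi c (X n w)) * \int[P]_w E (i_ n) w.
  (* The bound [n.+1] puts the current time into the past, as [psi c (X n)] multiplies the noise. *)
  apply: (@independent_past_expectation _ _ _ _ _ _ E X (i_ @` `I_n) `I_n.+1
    (i_ n) (fun w => F (t n w) * psi c (X n w)) id E_indep E_X_indep) => //.
  - by move=> [k /= kn /i_inj kE]; rewrite kE ltnn in kn.
  - have mX k : (k < n.+1)%N -> measurable_fun setT (X k : g_sigma_algebraType
        (events_of (fun i : J => E i : T -> R) (i_ @` `I_n) `|`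
         events_of (fun j : nat => X j : T -> R) `I_n.+1) -> R).
      move=> kn.
      apply: (measurable_past (Z := fun k => X k : T -> R) (S := `I_n.+1)) => //.
    apply: measurable_funM.
      apply: (measurableT_comp mF).
      apply: (@t_past n _ (g_sigma_algebraType
        (events_of (fun i : J => E i : T -> R) (i_ @` `I_n) `|`
         events_of (fun j : nat => X j : T -> R) `I_n.+1)) id) => k kn.
        by apply: mX; rewrite ltnS ltnW.
      apply: (measurable_past (Z := fun k => E k : T -> R) (S := i_ @` `I_n)).
        by exists k.
      exact: subsetUl.
    apply: (@measurableT_comp _ _ _ _ _ _ (psi c)); first by case: (bpsi c).
    exact: mX.
  - by apply: bounded_measurableM => //; exact: bX.
  - exact: E_int.
have e3 : \int[P]_w phi (X n w) = a * sin (2 * pi * theta + c) * fourier1 f.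
  rewrite (Rintegral_density _ (X_density n) mg bphi)//.
  rewrite -(Rintegral_sin_shape a v c bf f_even f_per); last first.
    by rewrite (le_trans (ltW theta_lt))//; lra.
  (* The division by [g] in the score cancels the density. *)
  apply: eq_Rintegral => x _; rewrite /phi /psi.
  by field; rewrite gt_eqF.
have -> : (fun w => F (t n w) * W c n w) = (fun w => F (t n w) * phi (X n w) +
    (F (t n w) * psi c (X n w)) * E (i_ n) w).
  by apply/funext => w; rewrite /W /phi; ring.
split; first exact: rintegrableD.
by rewrite (RintegralD _ i1 i2)// e1 e2 E_mean mulr0 addr0 e3.
Qed.

Let D_score n w : D n w =
  s * (cos (2 * pi * t n w) * W 0 n w - sin (2 * pi * t n w) * W (pi / 2) n w).
Proof.
by rewrite /D /W /psi addr0 sinDpihalf mulrBr sinB; ring.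
Qed.

Let mD n : measurable_fun setT (D n).
Proof.
apply: measurable_funM => //; apply: measurable_funM.
  apply: measurable_funM.
    apply: (@measurableT_comp _ _ _ _ _ _ (@sin R)).
      by apply: continuous_measurable_fun; exact: continuous_sin.
    by apply: measurable_funM => //; exact: measurable_funB.
  apply: (@measurableT_comp _ _ _ _ _ _ (fun x : R => (g x)^-1)) => //.
  by case: binvg.
apply: measurable_funD => //.
apply: (@measurableT_comp _ _ _ _ _ _ (fun x : R => a * f (x - theta) + v)) => //.
by case: bshift.
Qed.

(** Sign and sine are at most one in absolute value, [1/g <= 1/delta], and
    [(x + y)^2 <= 2 x^2 + 2 y^2] separates the bounded signal from the noise; hence the factor
    [2/delta^2]. *)
Let D_sqr_bound : exists C, forall n, rintegrable P (fun w => D n w ^+ 2) /\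
  \int[P]_w (D n w ^+ 2) <= C.
Proof.
have [_ [M fM]] := bshift.
pose b := delta^-1 ^+ 2 * 2.
have b0 : 0 <= b by rewrite mulr_ge0// sqr_ge0.
exists (b * M ^+ 2 + b * sigma2) => n.
have Dm : measurable_fun setT (fun w => D n w ^+ 2) by exact: measurable_funX.
have DM w : D n w ^+ 2 <= b * M ^+ 2 + b * E (i_ n) w ^+ 2.
  have h1 : s ^+ 2 <= 1.
    by rewrite -(real_normK (num_real s)) /s normr_sg; case: (_ != 0); rewrite ?expr1n ?expr0n.
  have h2 : sin (2 * pi * (X n w - t n w)) ^+ 2 <= 1.
    by rewrite sin2cos2 gerBl sqr_ge0.
  have h3 : (g (X n w))^-1 ^+ 2 <= delta^-1 ^+ 2.
    have h0 x : 0 <= (g x)^-1 by rewrite invr_ge0 (ltW (g_gt0 x)).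
    have h1' : 0 <= delta^-1 by rewrite invr_ge0 ltW.
    by rewrite ler_sqr ?nnegrE// lef_pV2 ?posrE.
  have h4 : (a * f (X n w - theta) + v + E (i_ n) w) ^+ 2 <=
      2 * (M ^+ 2 + E (i_ n) w ^+ 2).
    have : (a * f (X n w - theta) + v) ^+ 2 <= M ^+ 2.
      rewrite -(real_normK (num_real (_ + v))) ler_sqr ?nnegrE//.
      by rewrite (le_trans _ (fM (X n w))).
    have := sqr_ge0 (a * f (X n w - theta) + v - E (i_ n) w).
    rewrite !expr2; lra.
  rewrite /D !exprMn; move: (sqr_ge0 s) (sqr_ge0 (sin (2 * pi * (X n w - t n w))))
    (sqr_ge0 (g (X n w))^-1) (sqr_ge0 (a * f (X n w - theta) + v + E (i_ n) w)).
  move: h1 h2 h3 h4; set S := s ^+ 2; set U := sin _ ^+ 2; set V := (g _)^-1 ^+ 2.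
  set Y := (_ + E _ _) ^+ 2; clearbody S U V Y => h1 h2 h3 h4 S0 U0 V0 Y0.
  rewrite -mulrDr /b -[leRHS]mulrA -[leRHS]mul1r; apply: ler_pM => //.
    by rewrite !mulr_ge0//.
  apply: ler_pM => //; first by rewrite mulr_ge0.
  by rewrite -[leRHS]mul1r ler_pM.
have iM : rintegrable P (fun w => b * M ^+ 2 + b * E (i_ n) w ^+ 2).
  apply: rintegrableD; last exact: rintegrableZ.
  exact/brint/bounded_measurable_cst.
have iD : rintegrable P (fun w => D n w ^+ 2).
  by apply: rintegrable_dominated iM => // w; rewrite ger0_norm// sqr_ge0.
split=> //; apply: le_trans (_ : _ <= \int[P]_w (b * M ^+ 2 + b * E (i_ n) w ^+ 2)) _.
  by apply: le_Rintegral.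
rewrite RintegralD//; last 2 first.
- exact/brint/bounded_measurable_cst.
- exact: rintegrableZ.
rewrite Rintegral_probability_cst RintegralZl//; last exact: E2_int.
by rewrite lerD2l ler_wpM2l.
Qed.

(** A bound for [|2 pi (x - theta)|] over [x] in [K]; it is below [pi] because [|theta| < 1/4]. *)
Let y0 := 2 * pi * (4^-1 + `|theta|).

Let y0_lt_pi : y0 < pi.
Proof. by rewrite /y0; have := pi_gt0 R; move: theta_lt; nra. Qed.

(** With [z] the error, the sign [s] makes the mean equal to [-|a f1| E[z sin (2 pi z)]], and
    [mul_sin_ge] compares [z sin (2 pi z)] with [z^2]. *)
Let drift n : \int[P]_w ((t n w - theta) * D n w) <=
  - (`|a * fourier1 f| * (2 * pi * cos (y0 / 2) ^+ 2)) *
    \int[P]_w ((t n w - theta) ^+ 2).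
Proof.
(* [F0] and [F1] collect the factors that depend on the current iterate alone. *)
pose F0 (x : R) : R := (x - theta) * cos (2 * pi * x).
pose F1 (x : R) : R := (x - theta) * sin (2 * pi * x).
have Ktheta x : K x -> `|x - theta| <= 4^-1 + `|theta|.
  rewrite /K/= in_itv/= -ler_norml => xK.
  by rewrite (le_trans (ler_normB _ _))// lerD2r.
have Ktheta1 x : K x -> `|x - theta| <= 1.
  by move=> /Ktheta h; rewrite (le_trans h)//; move: theta_lt; lra.
have bsin (c : R) : bounded_measurable (fun x : R => sin (2 * pi * x + c)).
  exact: bounded_measurable_sin.
have mF0 : measurable_fun setT F0.
  rewrite /F0; under eq_fun do rewrite -sinDpihalf.
  by apply: measurable_funM; [exact: measurable_funB|case: (bsin (pi / 2))].
have mF1 : measurable_fun setT F1.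
  rewrite /F1; under eq_fun do rewrite -[2 * pi * _]addr0.
  by apply: measurable_funM; [exact: measurable_funB|case: (bsin 0)].
have F0_le x : K x -> `|F0 x| <= 1.
  move=> /Ktheta1 h; rewrite normrM mulr_ile1//.
  by rewrite ler_norml cos_geN1 cos_le1.
have F1_le x : K x -> `|F1 x| <= 1.
  move=> /Ktheta1 h; rewrite normrM mulr_ile1//.
  by rewrite ler_norml sin_geN1 sin_le1.
have [i0 e0] := score_mean 0 n mF0 F0_le.
have [i1 e1] := score_mean (pi / 2) n mF1 F1_le.
have iF0 := brint (bH n mF0 F0_le).
have iF1 := brint (bH n mF1 F1_le).
have mt := measurable_funB (tm n) (measurable_cst theta).
have bt : bounded_measurable (fun w => t n w - theta).
  by split; [exact: mt | exists 1 => w; exact/Ktheta1/tK].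
have -> : \int[P]_w ((t n w - theta) * D n w) = s * (a * fourier1 f) *
    \int[P]_w (sin (2 * pi * theta) * F0 (t n w) - cos (2 * pi * theta) * F1 (t n w)).
  transitivity (\int[P]_w (s * (F0 (t n w) * W 0 n w - F1 (t n w) * W (pi / 2) n w))).
    by apply: eq_Rintegral => w _; rewrite D_score /F0 /F1; ring.
  rewrite RintegralZl//; last first.
    by have := rintegrableD i0 (rintegrableZ (-1) i1); under eq_fun do rewrite mulN1r.
  rewrite RintegralB// e0 e1 RintegralB//; [|exact: rintegrableZ..].
  by rewrite !RintegralZl// addr0 sinDpihalf; ring.
rewrite -normrEsg [leRHS]mulNr -[X in _ <= - X]mulrA -[leRHS]mulrN ler_wpM2l//.
have it : rintegrable P (fun w => (t n w - theta) ^+ 2).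
  exact/brint/(bounded_measurableM bt bt).
rewrite -mulNr -RintegralZl//; apply: le_Rintegral => //.
- have := rintegrableD (rintegrableZ (sin (2 * pi * theta)) iF0)
    (rintegrableZ (- cos (2 * pi * theta)) iF1).
  by under eq_fun do rewrite mulNr.
- exact: rintegrableZ.
move=> w _; have := Ktheta _ (tK n w); set z := t n w - theta => z_le.
have pi0 := pi_gt0 R.
have -> : sin (2 * pi * theta) * F0 (t n w) - cos (2 * pi * theta) * F1 (t n w) =
    - (z * sin (2 * pi * z)).
  have ez : 2 * pi * z = 2 * pi * t n w - 2 * pi * theta by rewrite /z; ring.
  by rewrite ez sinB /F0 /F1 -/z; ring.
(* Multiplying by [2 pi] produces [y sin y] with [y = 2 pi z]. *)
rewrite mulNr lerN2 -(ler_pM2l (mulr_gt0 (ltr0Sn R 1) pi0)) [leRHS]mulrA.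
have : `|2 * pi * z| <= y0.
  by rewrite normrM ger0_norm ?mulr_ge0 ?(ltW pi0)// ler_wpM2l// mulr_ge0 ?(ltW pi0).
move=> /mul_sin_ge/(_ y0_lt_pi); congr (_ <= _); ring.
Qed.

Lemma ae_scalar_recursion :
  {ae P, forall w, t n w @[n --> \oo] --> theta /\
    finite_set [set n | ~ K (t n w + D n w / n.+1%:R)]}.
Proof.
have [C hC] := D_sqr_bound.
have c_gt0 : 0 < cos (y0 / 2).
  apply: cos_gt0_pihalf; rewrite ltr_pM2r ?invr_gt0// y0_lt_pi andbT.
  have y0_ge0 : 0 <= y0.
    by rewrite /y0 mulr_ge0 ?mulr_ge0 ?pi_ge0// addr_ge0.
  have := pi_gt0 R; lra.
apply: (@ae_of_robbins_monro _ _ _ _ t D theta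
  (`|a * fourier1 f| * (2 * pi * cos (y0 / 2) ^+ 2)) C) => //.
- by rewrite !(mulr_gt0, normr_gt0, pi_gt0, c_gt0).
- by move=> n; case: (hC n).
- by move=> n; case: (hC n).
Qed.

End ScalarRecursion.

(** * From one coordinate to the vector *)

Lemma cvg_mx_coord (R : realType) (m n : nat) (u : nat -> 'M[R]_(m, n))
    (l : 'M[R]_(m, n)) :
  (forall i j, u k i j @[k --> \oo] --> l i j) -> u k @[k --> \oo] --> l.
Proof.
move=> ucvg; apply/cvg_mx_entourageP => A entA.
apply: filter_forall => i; apply: filter_forall => j.
have [N _ hN] := ucvg i j _ (nbhs_entourage (l i j) entA).
by exists N => // k /hN.
Qed.

Lemma ae_forall_ord (R : realType) (d : measure_display) (T : measurableType d)
    (P : probability T R) (p : nat) (Q : 'I_p -> T -> Prop) :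
  (forall j, {ae P, forall w, Q j w}) -> {ae P, forall w, forall j, Q j w}.
Proof. by move=> Qj; apply: filter_forall. Qed.

(** The recursion sees the density only at the observation times, so [g] may be replaced by a
    function that agrees with it there. *)
Lemma rm_seq_eq_density (R : realType) (p : nat) (f g h : R -> R)
    (a t0 : 'cV[R]_p) (gamma x : nat -> R) (y : nat -> 'cV[R]_p) (n : nat) :
  (forall k, h (x k.+1) = g (x k.+1)) ->
  rm_seq f h a gamma t0 x y n = rm_seq f g a gamma t0 x y n.
Proof.
move=> hg; elim: n => //= n ->; congr (map_mx _ _).
by apply/matrixP => j k; rewrite !mxE hg.
Qed.

(** The mass of the complement of [D] is an integral over the empty set. *)
Lemma ae_has_density_on (R : realType) (d : measure_display)
    (T : measurableType d) (P : probability T R) (Z : {RV P >-> R})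
    (D : set R) (g : R -> R) :
  measurable D -> has_density_on Z D g -> {ae P, forall w, D (Z w)}.
Proof.
move=> mD Zg; exists (Z @^-1` (~` D)); split.
- by rewrite -[X in measurable X]setTI; apply: measurable_funPT => //; exact: measurableC.
- transitivity (distribution P Z (~` D)) => //.
  by rewrite Zg ?setICl ?integral_set0//; exact: measurableC.
- by [].
Qed.

(** * Moments of the noise *)

Section Noise.
Context (R : realType) (d : measure_display) (T : measurableType d)
  (P : probability T R).

(** The square is nonnegative, so a finite value of its extended expectation already gives
    integrability. *)
Lemma rintegrable_sqr_of_expectation (Z : {RV P >-> R}) (c : R) :
  ('E_P[(fun w => (Z w ^+ 2)%R)] = c%:E)%E ->
  rintegrable P (fun w => Z w ^+ 2) /\ \int[P]_w (Z w ^+ 2) = c.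
Proof.
rewrite unlock => Zc; split; last by rewrite /Rintegral Zc.
apply/integrableP; split.
  by apply/measurable_EFinP; exact: measurable_funX.
under eq_integral do rewrite /= ger0_norm ?sqr_ge0//.
by rewrite Zc ltry.
Qed.

Lemma rintegrable_of_sqr (Z : {RV P >-> R}) :
  rintegrable P (fun w => Z w ^+ 2) -> rintegrable P Z.
Proof.
move=> iZ; apply: (rintegrable_dominated (h2 := fun w => 1 + Z w ^+ 2)) => //.
  move=> w; rewrite -(real_normK (num_real (Z w))).
  have := sqr_ge0 (`|Z w| - 1); have := normr_ge0 (Z w).
  rewrite !expr2; lra.
apply: rintegrableD => //; apply: (@rintegrable_bounded _ _ _ _ _ 1) => // w.
by rewrite normr1.
Qed.

End Noise.
(* X i and eps i j are indexed by i >= 1; index 0 is unused. *)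
Theorem theorem4p1 (R : realType) (d : measure_display) (T : measurableType d)
    (P : probability T R) (p : nat) (hp : (1 < p)%N)
    (X : nat -> {RV P >-> R}) (eps : nat -> 'I_p -> {RV P >-> R})
    (g f : R -> R) (a theta v sigma theta0 : 'cV[R]_p)
    (* observation times *)
    (X_indep : mutually_independent P (fun i : nat => X i.+1 : T -> R))
    (X_density : forall i : nat, (0 < i)%N ->
       has_density_on (X i) `[- 2^-1, 2^-1] g)
    (g_gt0 : forall x : R, - 2^-1 <= x <= 2^-1 -> 0 < g x)
    (g_cont : continuous g)
    (g_derivable : forall x : R, derivable g x 1)
    (g_derivable2 : forall x : R, derivable (g^`())%classic x 1)
    (g'_bounded : exists M : R, forall x : R, `|(g^`())%classic x| <= M)
    (g''_bounded : exists M : R, forall x : R, `|(g^`(2))%classic x| <= M)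
    (* shape function *)
    (f_meas : measurable_fun setT f)
    (f_sym : forall x : R, f (- x) = f x)
    (f_bounded : exists M : R, forall x : R, `|f x| <= M)
    (f_periodic : periodic f 1)
    (f_int0 : \int[lebesgue_measure]_(x in `[(- 2^-1 : R), 2^-1]) f x = 0)
    (f1_neq0 : fourier1 f != 0)
    (* parameters *)
    (a_neq0 : forall j : 'I_p, a j 0 != 0)
    (a_first : a (Ordinal (ltnW hp)) 0 = 1)
    (theta_first : theta (Ordinal (ltnW hp)) 0 = 0)
    (theta_lt : forall j : 'I_p, `|theta j 0| < 4^-1)
    (* noise *)
    (eps_indep : mutually_independent P
       (fun ij : nat * 'I_p => eps ij.1.+1 ij.2 : T -> R))
    (eps_mean : forall (i : nat) (j : 'I_p), (0 < i)%N ->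
       ('E_P[eps i j] = 0)%E)
    (eps_var : forall (i : nat) (j : 'I_p), (0 < i)%N ->
       ('E_P[(fun w => (eps i j w ^+ 2)%R)] = (sigma j 0 ^+ 2)%:E)%E)
    (eps_ident : forall (i k : nat) (j : 'I_p), (0 < i)%N -> (0 < k)%N ->
       forall B : set R, measurable B ->
         distribution P (eps i j) B = distribution P (eps k j) B)
    (eps_X_indep : independent_families P
       (fun ij : nat * 'I_p => eps ij.1.+1 ij.2 : T -> R)
       (fun i : nat => X i.+1 : T -> R))
    (* initial value *)
    (theta0_K : forall j : 'I_p, K (theta0 j 0)) :
  let gamma : nat -> R := fun n => n%:R^-1 in
  let Y : nat -> T -> 'cV[R]_p := fun i w =>
    shape_invariant f a theta v (X i w) (fun j => eps i j w) in
  let thetahat : nat -> T -> 'cV[R]_p := fun n w =>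
    rm_seq f g a gamma theta0 (fun i => X i w) (fun i => Y i w) n in
  {ae P, forall w, thetahat n w @[n --> \oo] --> theta} /\
  forall j : 'I_p, {ae P, forall w,
    finite_set [set n : nat | ~ K
      (rm_step f g a (gamma n.+1) (thetahat n w) (X n.+1 w) (Y n.+1 w) j 0)]}.
Proof.
move=> gamma Y thetahat.
pose D : set R := `[- 2^-1, 2^-1]%classic.
have mD : measurable D by exact: measurable_itv.
(* [delta] is the minimum of [g] over the compact interval [D]. *)
have [delta delta_gt0 g_ge] : exists2 delta : R, 0 < delta &
    forall x, D x -> delta <= g x.
  have h : - 2^-1 <= 2^-1 :> R by lra.
  have [c cD gc] := EVT_min h (continuous_subspaceT g_cont).
  by exists (g c) => [|x]; [apply: g_gt0; move: cD; rewrite in_itv|exact: gc].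
(* [g] may vanish off [D]; [h] agrees with it along almost every path and has
   a bounded inverse on the whole line. *)
pose h x := Num.max (g x) delta.
have h_cont : continuous h.
  by move=> x; apply: continuous_max; [exact: g_cont|exact: cst_continuous].
have hg x : D x -> h x = g x by move=> Dx; rewrite /h max_l// g_ge.
have h_density n : has_density_on (X n.+1) D h.
  move=> B mB; rewrite (X_density n.+1 isT)//.
  by apply: eq_integral => x /set_mem[_ /hg->].
have [M fM] := f_bounded.
have bf : bounded_measurable f by split=> //; exists M.
have noise i j : rintegrable P (fun w => eps i.+1 j w ^+ 2) /\
    \int[P]_w (eps i.+1 j w ^+ 2) = sigma j 0 ^+ 2.
  exact: rintegrable_sqr_of_expectation (eps_var i.+1 j isT).
have noise1 i j : rintegrable P (eps i.+1 j).
  by apply: rintegrable_of_sqr; case: (noise i j).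
have noise0 i j : \int[P]_w eps i.+1 j w = 0.
  by have := eps_mean i.+1 j isT; rewrite unlock /Rintegral => ->.
(* The iterates driven by [h] are treated first; they coincide with [thetahat] on the almost sure
   event that all times lie in [D]. *)
pose t j n w := rm_seq f h a gamma theta0 (fun i => X i w) (fun i => Y i w) n j 0.
have tcvg j : {ae P, forall w, t j n w @[n --> \oo] --> theta j 0 /\
    finite_set [set n | ~ K (t j n w + Num.sg (a j 0 * fourier1 f) *
      (sin (2 * pi * (X n.+1 w - t j n w)) / h (X n.+1 w) *
       (a j 0 * f (X n.+1 w - theta j 0) + v j 0 + eps n.+1 j w)) / n.+1%:R)]}.
  apply: (@ae_scalar_recursion _ _ _ P _ (fun n => X n.+1)
    (fun ij : nat * 'I_p => eps ij.1.+1 ij.2) (fun n => (n, j)) f h (a j 0)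
    (theta j 0) (v j 0) (theta0 j 0) delta (sigma j 0 ^+ 2) (t j)) => //.
  - by move=> m n [].
  - by move=> x; rewrite /h le_max lexx orbT.
  - by rewrite mulf_neq0.
  - by move=> n; case: (noise n j).
  - by move=> n; have [_ ->] := noise n j.
  - move=> n w; rewrite {1}/t /= !mxE; congr Defs.projK.
    by rewrite /gamma /t; ring.
have XD : {ae P, forall w, forall n, D (X n.+1 w)}.
  by apply: ae_foralln => n; exact: ae_has_density_on (X_density n.+1 isT).
have thetahatE w : (forall n, D (X n.+1 w)) ->
    forall n j, thetahat n w j 0 = t j n w.
  move=> Dw n j; rewrite /thetahat /t (@rm_seq_eq_density _ _ _ g h)//.
  by move=> k; rewrite hg.
split.
  have := ae_forall_ord tcvg.
  apply: filterS2 XD => w Dw tw; apply: cvg_mx_coord => j k.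
  rewrite ord1; under eq_fun do rewrite thetahatE//.
  by case: (tw j).
move=> j; apply: filterS2 XD (tcvg j) => w Dw [_].
apply: sub_finite_set => n /=; apply: contra_not.
rewrite mxE thetahatE// !mxE thetahatE// hg//.
by congr K; rewrite /gamma; ring.
Qed.
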